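(* Let $P$ be a reduced knot projection. Then: (1) $t(P)\le r(P)$. (2) $t(P)\le y(P)$. (3) $t(P)\le i(P)$. (4) $i(P)$ is an even nonnegative integer. (5) If $P$ has at least one coherent $2$-gon, then $i(P)=2$. (6) If $P$ has at least one $3$-gon of type $C$, then $i(P)=2$. (7) If $P$ has at least one $3$-gon of type $A$, then $1\le y(P)\le 2$. Moreover, (8) for any even positive integer $2m$, there exists a reduced knot projection $P$ with $i(P)=2m$.
   Context: A knot projection is the image of a generic immersion of an unoriented circle into the sphere $S^2$ (the only singularities are transverse double points); every knot projection is assumed to have at least one double point. A double point $c$ of $P$ is nugatory if there is a simple closed curve in $S^2$ meeting $P$ only at $c$ and transverse there to both branches of $P$. A knot projection is reducible if it has a nugatory double point, and reduced otherwise. A splice at a double point removes a small neighbourhood of the double point and reconnects the four ends in one of the two planar ways without a crossing. Orient $P$ arbitrarily: the splice compatible with the orientation is the Seifert splice (applied alone it produces two closed curves); the other is the non-Seifert splice (applied alone it produces one closed curve). This does not depend on the orientation chosen. Reductivities: $t(P)$ is the minimum number of splices (each of either kind), applied simultaneously at distinct double points of $P$, needed to obtain a reducible knot projection (in particular a single closed curve) from $P$; $r(P)$ is the minimum number of non-Seifert splices, applied recursively (each applied to the knot projection resulting from the previous ones, and non-Seifert with respect to it), needed to obtain a reducible knot projection from $P$; $y(P)$ (respectively $i(P)$) is the minimum number of non-Seifert (respectively Seifert) splices, applied simultaneously at distinct double points of $P$ (their kind being determined by $P$), needed to obtain a reducible knot projection from $P$. All four are $0$ if $P$ is reducible. An $n$-gon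 of $P$ is a connected component of $S^2\setminus P$ that is a disk whose boundary consists of $n$ edges joining $n$ distinct double points (its vertices). A $2$-gon with vertices $1,2$ is coherent if, traversing $P$ once, its vertices are met in the cyclic order $1,2,2,1$, where consecutive pairs $12$ and $21$ are the two edges of the $2$-gon (that is, any orientation of $P$ orients the boundary of the $2$-gon cyclically). A $3$-gon is of type $C$ if its vertices can be labelled $1,2,3$ so that, traversing $P$ once, they are met in the cyclic order $1,2,3,1,2,3$ with the three edges of the $3$-gon traversed as $12$, $31$, $23$. A $3$-gon is of type $A$ if its vertices can be labelled $1,2,3$ so that, traversing $P$ once, they are met in the cyclic order $1,2,3,2,1,3$ with the three edges of the $3$-gon traversed as $12$, $32$, $13$. *)

(* Defs.v *)
From mathcomp Require Import all_boot.

Set Implicit Arguments.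
Unset Strict Implicit.
Unset Printing Implicit Defensive.

(* Generic closed curves on the oriented sphere are encoded by rotation systems
   on a finite set D of darts (half-edges): [opp d] is the other half of the
   edge of d, and [rot d] is the next dart counterclockwise around the vertex at
   which d starts.  Double points are the vertices of degree 4.  Vertices of
   degree 2 are also allowed: they are regular points of the curve that happen
   to be marked, and are what a splice leaves behind. *)
Record diagram (D : finType) := Diagram { opp : D -> D; rot : D -> D }.

Definition well_formed (D : finType) (P : diagram D) : Prop :=
  [/\ involutive (opp P), forall d, opp P d != d, injective (rot P)
    & forall d, order (rot P) d \in [:: 2; 4]].

Definition vertex (D : finType) (P : diagram D) (d : D) : {set D} :=
  [set e | fconnect (rot P) d e].

Definition double_points (D : finType) (P : diagram D) : {set {set D}} :=
  [set vertex P d | d : D & order (rot P) d == 4].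

(* The face-orbit of d consists of the darts with, on their right, the component
   of the complement of the curve that lies on the right of d.  The corner of
   that component at the start of d is the one clockwise from d. *)
Definition face (D : finType) (P : diagram D) (d : D) : D := rot P (opp P d).

(* The dart facing d across the vertex at which d starts. *)
Definition through (D : finType) (P : diagram D) (d : D) : D :=
  if order (rot P) d == 4 then rot P (rot P d) else rot P d.

(* Traversal: run along d, then straight on through the vertex at its end. *)
Definition trav (D : finType) (P : diagram D) (d : D) : D := through P (opp P d).

Definition single_curve (D : finType) (P : diagram D) : Prop :=
  forall d e, fconnect (trav P) d e || fconnect (trav P) d (opp P e).

(* V + F = E + 2; used for connected diagrams only. *)
Definition spherical (D : finType) (P : diagram D) : Prop :=
  fcard (rot P) D + fcard (face P) D = fcard (opp P) D + 2.

Definition marked_knot_projection (D : finType) (P : diagram D) : Prop :=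
  [/\ well_formed P, single_curve P, spherical P & double_points P != set0].

Definition knot_projection (D : finType) (P : diagram D) : Prop :=
  marked_knot_projection P /\ forall d, order (rot P) d = 4.

(* A simple closed curve meeting the projection only at c, transversely to both
   branches, leaves c through two opposite corners and otherwise stays in one
   component of the complement; it exists as soon as two opposite corners at c
   belong to the same component, since components are path connected. *)
Definition nugatory (D : finType) (P : diagram D) (c : {set D}) : Prop :=
  c \in double_points P /\
  exists2 d, d \in c & fconnect (face P) d (rot P (rot P d)).

Definition reducible (D : finType) (P : diagram D) : Prop :=
  marked_knot_projection P /\ exists c, nugatory P c.

Definition reduced (D : finType) (P : diagram D) : Prop :=
  knot_projection P /\ ~ exists c, nugatory P c.

(* For a single curve, [trav] has two orbits of darts, one for each orientation;
   d and e are codirected when they point along the same one. *)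
Definition codirected (D : finType) (P : diagram D) (d e : D) : bool :=
  fconnect (trav P) d e.

(* A planar reconnection at a double point joins each dart to one of its two
   neighbours.  With respect to an orientation, the Seifert splice joins an
   outgoing end to an incoming one; the non-Seifert splice joins two outgoing
   ends and two incoming ends.  [iter 3 (rot P)] is a clockwise step. *)
Definition seifert_partner (D : finType) (P : diagram D) (d : D) : D :=
  if codirected P d (rot P d) then iter 3 (rot P) d else rot P d.

Definition nonseifert_partner (D : finType) (P : diagram D) (d : D) : D :=
  if codirected P d (rot P d) then rot P d else iter 3 (rot P) d.

(* Simultaneous Seifert splices at S and non-Seifert splices at N, all kinds
   being determined by P; each spliced vertex becomes two vertices of degree 2. *)
Definition splice (D : finType) (P : diagram D) (S N : {set {set D}}) : diagram D :=
  Diagram (opp P) (fun d =>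
    if vertex P d \in S then seifert_partner P d
    else if vertex P d \in N then nonseifert_partner P d
    else rot P d).

Definition least (A : nat -> Prop) (n : nat) : Prop :=
  A n /\ forall m, A m -> n <= m.

Definition is_t (D : finType) (P : diagram D) : nat -> Prop :=
  least (fun k => exists S N : {set {set D}},
    [/\ S \subset double_points P, N \subset double_points P, [disjoint S & N],
        #|S| + #|N| = k & reducible (splice P S N)]).

Fixpoint reducible_after (D : finType) (k : nat) (P : diagram D) : Prop :=
  if k is k'.+1 then
    exists2 c, c \in double_points P & reducible_after k' (splice P set0 [set c])
  else reducible P.

Definition is_r (D : finType) (P : diagram D) : nat -> Prop :=
  least (fun k => reducible_after k P).

Definition is_y (D : finType) (P : diagram D) : nat -> Prop :=
  least (fun k => exists N : {set {set D}},
    [/\ N \subset double_points P, #|N| = k & reducible (splice P set0 N)]).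

Definition is_i (D : finType) (P : diagram D) : nat -> Prop :=
  least (fun k => exists S : {set {set D}},
    [/\ S \subset double_points P, #|S| = k & reducible (splice P S set0)]).

(* The component of the complement on the right of d is an n-gon. *)
Definition is_gon (D : finType) (P : diagram D) (n : nat) (d : D) : Prop :=
  order (face P) d = n /\ uniq [seq vertex P e | e <- orbit (face P) d].

Definition on_boundary (D : finType) (P : diagram D) (d e : D) : bool :=
  fconnect (face P) d e || fconnect (face P) d (opp P e).

(* The successive passages of the traversal starting with x through the vertices
   of the polygon on the right of d; a passage is given by the dart along which
   it leaves the vertex. *)
Definition passages (D : finType) (P : diagram D) (d x : D) : seq D :=
  [seq y <- orbit (trav P) x
     | vertex P y \in [seq vertex P e | e <- orbit (face P) d]].

(* The vertices of the polygon are met in the order w, and the steps from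
   w_0 to w_1, from w_2 to w_3, and so on, are along edges of the polygon. *)
Definition traversed_as (D : finType) (P : diagram D) (d : D)
    (w : seq {set D}) : Prop :=
  exists x : D, [seq vertex P y | y <- passages P d x] = w /\
    forall k, k < order (face P) d -> on_boundary P d (nth x (passages P d x) k.*2).

Definition coherent_2gon (D : finType) (P : diagram D) (d : D) : Prop :=
  is_gon P 2 d /\ exists v1 v2, traversed_as P d [:: v1; v2; v2; v1].

Definition type_C_3gon (D : finType) (P : diagram D) (d : D) : Prop :=
  is_gon P 3 d /\
  exists v1 v2 v3, traversed_as P d [:: v1; v2; v3; v1; v2; v3].

Definition type_A_3gon (D : finType) (P : diagram D) (d : D) : Prop :=
  is_gon P 3 d /\
  exists v1 v2 v3, traversed_as P d [:: v1; v2; v3; v2; v1; v3].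

(* Main.v *)
From Stdlib Require Import FunctionalExtensionality Classical.
From mathcomp Require Import fingroup perm.
From mathcomp Require Import all_boot zify.
Require Import Defs.

Set Implicit Arguments.
Unset Strict Implicit.
Unset Printing Implicit Defensive.

(** Everything happens on permutations of darts.  Splicing a double point
    composes the rotation, the face permutation and the traversal with
    transpositions, and a transposition joins two cycles or cuts one.  Hence a
    splice adds a vertex and changes the number of faces by one, a Seifert
    splice changes the number of curves by one, and a non-Seifert splice of a
    single curve leaves one curve.

    Genus.  A splice never decreases V + F - E, and a connected diagram has V +
    F - E at most 2 ([connected_euler]); so a splice of a spherical diagram is
    spherical as soon as it is a single curve ([single_spherical]).
    Reducibility thus comes down to having one curve and a nugatory double
    point.

    Existence.  If c is not nugatory, some double point v is interlaced with c,
    that is, separated by the Seifert splice at c ([nugatory_or_interlaced]):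
    otherwise the darts of one of the two curves would form a connected
    component, and the two corners joined by the splice would lie in one face.
    Given a prescribed planar reconnection at each double point, reducibility is
    therefore reached greedily: splice a double point where the prescription is
    non-Seifert for the current curve, or else two interlaced ones
    ([reducible_resolution]).  The process cannot use up all double points,
    because splicing every double point in the Seifert way never gives a single
    curve on the sphere ([all_seifert_not_single]).  Prescribing the Seifert,
    respectively the non-Seifert, splices of P gives the existence of i(P),
    respectively y(P); for r(P), any non-Seifert splice can be made
    ([reducible_after_exists]).  The inequalities with t(P) hold because every
    recursive choice of splices is a simultaneous one, and i(P) is even because
    the number of curves changes parity at each Seifert splice
    ([seifert_single_even]).

    Polygons.  Splice all vertices of a polygon but one, each time so that its
    corner in the polygon is kept: the polygon becomes a loop and the last
    vertex becomes nugatory ([polygon_nugatory]).  Such a splice is Seifert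
    exactly when the two sides at the corner are coherently oriented.  In a
    coherent 2-gon one vertex is spliced, together with any double point
    interlaced with it; in a 3-gon of type C two vertices, which are interlaced;
    in a 3-gon of type A the two vertices with incoherent corners, whose
    passages are nested, so that the second splice is still non-Seifert after
    the first.  Evenness and i(P) > 0 then force i(P) = 2.

    Sharpness.  The projection of the (2, 2m+1) torus knot is a closed braid of
    two strands; its Seifert splices just erase crossings, and as long as two
    crossings are left no crossing is nugatory ([splice_braid_nugatory]).  So
    all crossings but one have to be spliced and i = 2m. *)

(** * Transpositions and numbers of cycles *)

Lemma porbit_fconnect (T : finType) (s : {perm T}) x y :
  (y \in porbit s x) = fconnect s x y.
Proof.
apply/porbitP/idP => [[i ->]|/iter_findex <-].
  by rewrite permX fconnect_iter.
by exists (findex s x y); rewrite permX.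
Qed.

Lemma fcard_porbits (T : finType) (s : {perm T}) : fcard s T = #|porbits s|.
Proof.
have syms : connect_sym (frel s) by apply: fconnect_sym perm_inj.
have -> : porbits s = porbit s @: froots s.
  apply/setP=> X; apply/imsetP/imsetP => [[x _ ->]|[x _ ->]]; last by exists x.
  exists (froot s x); first exact: roots_root.
  by apply/eqP; rewrite eq_porbit_mem porbit_fconnect -syms connect_root.
rewrite card_in_imset; first by apply: eq_card => x; rewrite !inE andbT.
move=> x y /eqP rx /eqP ry /eqP; rewrite eq_porbit_mem porbit_fconnect syms.
by rewrite -(root_connect syms) rx ry => /eqP.
Qed.

Lemma fconnect_agree (T : finType) (f h : T -> T) x :
  (forall z, fconnect f x z -> h z = f z) -> fconnect h x =1 fconnect f x.
Proof.
move=> agree; have E n : iter n h x = iter n f x.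
  by elim: n => //= n ->; rewrite agree ?fconnect_iter.
move=> y; apply/idP/idP => /iter_findex <-.
  by rewrite E fconnect_iter.
by rewrite -E fconnect_iter.
Qed.

Section TranspositionCount.

Variables (T : finType) (f : T -> T).
Hypothesis injf : injective f.

Lemma fcard_comp_tperm x y : x != y ->
  fcard (f \o tperm x y) T + (~~ fconnect f x y).*2 = (fcard f T).+1.
Proof.
move=> neq_xy; have Ef : f =1 perm injf by move=> z; rewrite permE.
have Eft : f \o tperm x y =1 (tperm x y * perm injf)%g.
  by move=> z; rewrite permM permE.
rewrite (eq_fcard Ef) (eq_fcard Eft) !fcard_porbits (eq_fconnect Ef).
have := porbits_mul_tperm (perm injf) x y.
by rewrite /= porbit_sym porbit_fconnect neq_xy addn1.
Qed.

Lemma fcard_tperm_comp x y : x != y ->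
  fcard (tperm x y \o f) T + (~~ fconnect f x y).*2 = (fcard f T).+1.
Proof.
move=> neq_xy; have Ef : f =1 perm injf by move=> z; rewrite permE.
have Eft : tperm x y \o f =1 (tperm x y * (perm injf)^-1)^-1%g.
  by move=> z; rewrite invMg invgK tpermV permM permE.
rewrite (eq_fcard Ef) (eq_fcard Eft) !fcard_porbits (eq_fconnect Ef) porbitsV.
have := porbits_mul_tperm (perm injf)^-1%g x y.
by rewrite /= porbit_sym porbitV porbitsV porbit_fconnect neq_xy addn1.
Qed.

Lemma inj_tperm_comp x y : injective (tperm x y \o f).
Proof. exact: inj_comp perm_inj injf. Qed.

Lemma inj_comp_tperm x y : injective (f \o tperm x y).
Proof. exact: inj_comp injf perm_inj. Qed.

Lemma fconnect_tperm_off x y z : ~~ fconnect f z x -> ~~ fconnect f z y ->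
  fconnect (tperm x y \o f) z =1 fconnect f z.
Proof.
move=> zx zy; apply: fconnect_agree => u zu /=.
have zfu: fconnect f z (f u) by rewrite -same_fconnect1_r.
by rewrite tpermD //; [apply: contraNneq zx | apply: contraNneq zy] => ->.
Qed.

End TranspositionCount.

(** Composing twice gives f back, and the number of cycles changes by one each
    time, upwards exactly when x and y are on one cycle beforehand. *)
Lemma fconnect_tperm_flip (T : finType) (f : T -> T) x y :
  injective f -> x != y ->
  fconnect (tperm x y \o f) x y = ~~ fconnect f x y.
Proof.
move=> injf neq_xy; have E1 := fcard_tperm_comp injf neq_xy.
have := fcard_tperm_comp (inj_tperm_comp injf (x := x) (y := y)) neq_xy.
have Ef : tperm x y \o (tperm x y \o f) =1 f by move=> z /=; rewrite tpermK.
rewrite (eq_fcard Ef).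
by move: E1; do 2!case: (fconnect _ x y) => /=; lia.
Qed.

Lemma fconnect_tperm_merge (T : finType) (f : T -> T) x y z :
  injective f -> x != y -> ~~ fconnect f x y ->
  fconnect f x z || fconnect f y z -> fconnect (tperm x y \o f) x z.
Proof.
move=> injf neq_xy nxy; set h := _ \o _.
have hxy : fconnect h x y by rewrite fconnect_tperm_flip.
have injh : injective h by apply: inj_tperm_comp.
have clo u : fconnect h x u -> fconnect h x (f u).
  move=> xu; have : fconnect h x (h u) by rewrite -(same_fconnect1_r injh).
  rewrite {2}/h /=.
  by case: (tpermP x y (f u)) => [->|->|//] _; rewrite ?connect0 ?hxy.
have iterP u n : fconnect h x u -> fconnect h x (iter n f u).
  by move=> xu; elim: n => //= n; apply: clo.
by case/orP=> /iter_findex <-; apply: iterP.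
Qed.

(** * The Euler inequality for connected maps *)

(** The colours stand for the components of the graph spanned by the cycles of f
    and the transpositions.  Joining two components costs one colour and, at the
    same time, one cycle; any other transposition adds at most one cycle. *)
Lemma fcard_comp_tperms (T : finType) (f : T -> T) (ts : seq (T * T)) :
  injective f ->
  let g := foldr (fun p h => h \o tperm p.1 p.2) f ts in
  exists col : T -> T,
    [/\ forall x, col (f x) = col x,
        forall p, p \in ts -> col p.1 = col p.2
      & fcard f T + fcard g T <= (#|codom col|).*2 + size ts].
Proof.
move=> injf /=; elim: ts => [|[x y] ts [col [colf colts le_c]]] /=.
  exists (froot f); split=> // [x|].
    by apply/esym/(rootP (fconnect_sym injf)); rewrite fconnect1.
  rewrite addn0 addnn leq_double; apply/subset_leq_card/subsetP => x.
  by rewrite inE andbT => /eqP <-; apply: codom_f.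
set g := foldr _ f ts in le_c *.
have injg : injective g.
  by rewrite /g; elim: (ts) => //= p s IH; apply: inj_comp_tperm.
have [-> | neq_xy] := eqVneq x y.
  have Eg : g \o tperm y y =1 g by move=> z /=; rewrite tperm1 perm1.
  exists col; split=> // [p|].
    by rewrite inE => /orP[/eqP-> //|]; apply: colts.
  by rewrite (eq_fcard Eg) addnS; apply: leqW.
have := fcard_comp_tperm injg neq_xy => card_gt.
have [eq_col | neq_col] := eqVneq (col x) (col y).
  exists col; split=> // [p|].
    by rewrite inE => /orP[/eqP-> //|]; apply: colts.
  by move: card_gt le_c; case: (fconnect g x y) => /=; lia.
pose col' z := if col z == col y then col x else col z.
have colg z : col (g z) = col z.
  rewrite /g; elim: (ts) colts z => [|[u v] s IH] //= colts z.
  rewrite IH => [|p ps]; last by apply: colts; rewrite inE ps orbT.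
  have /= := colts (u, v) (mem_head _ _).
  by case: (tpermP u v z) => [->|->|//].
have ngxy : ~~ fconnect g x y.
  apply/negP => gxy; case/eqP: neq_col.
  have := fconnect_invariant (k := col) (f := g) _ gxy; apply.
  by move=> z /=; rewrite colg eqxx.
exists col'; split=> [z|p|].
- by rewrite /col' colf.
- rewrite inE /col' => /orP[/eqP-> /=|/colts->//].
  by rewrite eqxx; case: eqP.
have le_col : #|codom col| <= #|codom col'|.+1.
  have sub : {subset codom col <= col y :: codom col'}.
    move=> _ /codomP[z ->]; rewrite inE; case: eqP => //= /eqP ne.
    by have := codom_f col' z; rewrite /col' (negPf ne).
  apply: leq_trans (subset_leq_card (introT subsetP sub)) _.
  rewrite cardU1 -add1n leq_add2r; by case: (_ \in _).
move: card_gt le_c le_col; rewrite ngxy /=; set A := #|codom col|; set B :=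
  #|codom col'|; set C := fcard (g \o _) _; lia.
Qed.

Lemma fconnect_involution (T : finType) (f : T -> T) x y :
  involutive f -> fconnect f x y = (y == x) || (y == f x).
Proof.
move=> fK; apply/idP/orP => [/iter_findex <-|[]/eqP->]; last exact: fconnect1.
  elim: (findex _ _ _) => [|n IH]; [by left | case: IH => /eqP /= ->].
    by right.
  by left; rewrite fK.
exact: connect0.
Qed.

Lemma involution_tperms (T : finType) (o f : T -> T) :
  involutive o -> (forall x, o x != x) ->
  exists2 ts : seq (T * T), size ts = fcard o T /\ (forall x, (x, o x)
    \in ts \/ (o x, x) \in ts) &
  foldr (fun p h => h \o tperm p.1 p.2) f ts =1 f \o o.
Proof.
move=> oK oN; pose r := enum (froots o).
have symo : connect_sym (frel o) by apply: fconnect_sym (can_inj oK).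
have rootE x : froot o (o x) = froot o x.
  by apply/esym/(rootP symo); rewrite fconnect1.
have rN x : x \in r -> o x \notin r.
  rewrite !mem_enum => /eqP rx; apply/negP => /eqP.
  by rewrite rootE rx => /esym/eqP; rewrite (negPf (oN x)).
have rV x : (x \in r) || (o x \in r).
  have := connect_root (frel o) x; rewrite fconnect_involution //.
  have: froot o x \in r by rewrite mem_enum; apply: roots_root.
  by move=> + /orP[]/eqP xr; rewrite xr => ->; rewrite ?orbT.
exists [seq (x, o x) | x <- r].
  split; first by rewrite size_map -cardE; apply: eq_card => x;
    rewrite !inE andbT.
  move=> x; case/orP: (rV x) => xr; first by left; apply: map_f.
  by right; rewrite -{2}(oK x); apply: map_f.
have E s z : {subset s <= r} -> uniq s ->
   foldr (fun p h => h \o tperm p.1 p.2) f [seq (x, o x) | x <- s] z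
   = if (z \in s) || (o z \in s) then f (o z) else f z.
  elim: s z => [|x s IH] //= z sub /andP[xs us].
  have xr : x \in r by apply: sub; rewrite mem_head.
  have sub' : {subset s <= r} by move=> u us'; apply: sub; rewrite inE us' orbT.
  have oxs : o x \notin s by apply/negP=> /sub'; rewrite (negPf (rN _ xr)).
  rewrite IH // !inE; case: (tpermP x (o x) z) => [->|->|].
  - by rewrite eqxx oK (negPf xs) (negPf oxs).
  - by rewrite !oK eqxx orbT (negPf xs) (negPf oxs).
  move=> /eqP/negPf zx /eqP/negPf zox; rewrite zx.
  by rewrite -(inj_eq (can_inj oK)) oK zox.
by move=> z; rewrite E ?enum_uniq // rV.
Qed.

(** With o the edge involution and f the rotation, f \o o is the face
    permutation and the bound reads V + F <= E + 2.  Connectedness is expressed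
    by saying that an invariant colouring is constant. *)
Lemma connected_euler (T : finType) (o f : T -> T) :
  involutive o -> (forall x, o x != x) -> injective f ->
  (forall col : T -> T, (forall x, col (o x) = col x) ->
     (forall x, col (f x) = col x) -> forall x y, col x = col y) ->
  fcard f T + fcard (f \o o) T <= fcard o T + 2.
Proof.
move=> oK oN injf conn; have [ts [<- tsP] Eo] := involution_tperms f oK oN.
have [col [colf colts]] := fcard_comp_tperms ts injf; rewrite (eq_fcard Eo).
have colo x : col (o x) = col x by case: (tsP x) => /colts /= ->.
suff : #|codom col| <= 1 by lia.
apply/card_le1P => u /codomP[x ->] v; rewrite [RHS]inE; apply/idP/eqP =>
  [/codomP[y ->]|->].
  exact: conn.
exact: codom_f.
Qed.

(** * Darts, double points, curves and orientations *)

Section WellFormed.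

Variables (D : finType) (P : diagram D).
Hypothesis wfP : well_formed P.

Lemma oppK : involutive (opp P). Proof. by case: wfP. Qed.
Lemma opp_neq d : opp P d != d. Proof. by case: wfP. Qed.
Lemma rot_inj : injective (rot P). Proof. by case: wfP. Qed.
Lemma opp_inj : injective (opp P). Proof. exact: can_inj oppK. Qed.
Lemma face_inj : injective (face P). Proof. exact: inj_comp rot_inj opp_inj.
  Qed.

Lemma order_rot_neq4 d : order (rot P) d != 4 -> order (rot P) d = 2.
Proof.
by case: wfP => _ _ _ /(_ d); rewrite !inE => /orP[/eqP->//|->].
Qed.

Lemma fconnect_order d e :
  fconnect (rot P) d e -> order (rot P) d = order (rot P) e.
Proof.
move=> de; apply: eq_card => u; exact: (same_connect (fconnect_sym rot_inj))
  de u.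
Qed.

Lemma order_rot d : order (rot P) (rot P d) = order (rot P) d.
Proof. by apply/esym/fconnect_order/fconnect1. Qed.

Lemma rot2 d : order (rot P) d != 4 -> rot P (rot P d) = d /\ rot P d != d.
Proof.
move=> /order_rot_neq4 o2; have := iter_order rot_inj d.
have := orbit_uniq (rot P) d; rewrite /orbit o2 /= !inE andbT eq_sym.
by move=> ? ->.
Qed.

Lemma rot4 d : order (rot P) d = 4 ->
  [/\ rot P (rot P (rot P (rot P d))) = d,
      uniq [:: d; rot P d; rot P (rot P d); rot P (rot P (rot P d))]
    & forall e, fconnect (rot P) d e =
       (e \in [:: d; rot P d; rot P (rot P d); rot P (rot P (rot P d))])].
Proof.
move=> o4; have E : orbit (rot P) d =
  [:: d; rot P d; rot P (rot P d); rot P (rot P (rot P d))].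
  by rewrite /orbit o4.
split; [have := iter_order rot_inj d | have := orbit_uniq (rot P) d |];
  rewrite -?E ?o4 //.
by move=> e; rewrite fconnect_orbit E.
Qed.

Lemma throughK : involutive (through P).
Proof.
move=> d; rewrite /through; case: (eqVneq (order _ d) 4) => [o4|o2].
  by rewrite !order_rot o4 eqxx; case: (rot4 o4).
by rewrite order_rot (negPf o2); case: (rot2 o2).
Qed.

Lemma through_neq d : through P d != d.
Proof.
rewrite /through; case: (eqVneq (order _ d) 4) => [o4|/rot2[]//].
case: (rot4 o4) => _ + _; rewrite eq_sym; rewrite /= !inE !negb_or.
by case/andP=> /and3P[].
Qed.

Lemma fconnect_through d : fconnect (rot P) d (through P d).
Proof.
rewrite /through; case: ifP => _; last exact: fconnect1.
by rewrite -!(same_fconnect1_r rot_inj) connect0.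
Qed.

Lemma trav_inj : injective (trav P).
Proof. exact: inj_comp (can_inj throughK) opp_inj. Qed.

Lemma trav_opp_trav d : trav P (opp P (trav P d)) = opp P d.
Proof. by rewrite /trav oppK throughK. Qed.

Lemma fconnect_trav_opp d e :
  fconnect (trav P) (opp P d) (opp P e) = fconnect (trav P) d e.
Proof.
suff imp x y : fconnect (trav P) x y -> fconnect (trav P) (opp P x) (opp P y).
  by apply/idP/idP => /imp //; rewrite !oppK.
move=> /iter_findex <-; rewrite (fconnect_sym trav_inj).
elim: (findex _ _ _) => [|n IH]; first exact: connect0.
apply: connect_trans IH.
have := fconnect1 (trav P) (opp P (trav P (iter n (trav P) x))).
by rewrite trav_opp_trav.
Qed.

(** The traversal never runs back along an edge it has used: otherwise it would
    turn round somewhere, in the middle of an edge or at a vertex. *)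
Lemma trav_oppF d : fconnect (trav P) d (opp P d) = false.
Proof.
apply/negP => /iter_findex; move: (findex _ _ _) => n.
have [k] := ubnP n; elim: k n d => // k IH [|[|n]] d; rewrite ?ltnS => lt_k.
- by move=> /= E; have := opp_neq d; rewrite -E eqxx.
- by move=> E; have := through_neq (opp P d); rewrite -{2}E eqxx.
rewrite -(trav_opp_trav d) !iterSr => /= E.
apply: (IH n (trav P d)); first exact: ltnW.
by apply: trav_inj; rewrite -iterS iterSr.
Qed.

Lemma mem_vertex d e : (e \in vertex P d) = fconnect (rot P) d e.
Proof. by rewrite inE. Qed.

Lemma vertex_id d : d \in vertex P d. Proof. by rewrite inE connect0. Qed.

Lemma eq_vertex d e : (vertex P d == vertex P e) = fconnect (rot P) d e.
Proof.
apply/eqP/idP => [E|de]; first by rewrite -mem_vertex E vertex_id.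
by apply/setP=> u; rewrite !inE; exact: (same_connect (fconnect_sym rot_inj))
  de u.
Qed.

Lemma mem_vertex_eq d e : d \in vertex P e -> vertex P d = vertex P e.
Proof. by rewrite mem_vertex -eq_vertex eq_sym => /eqP. Qed.

Lemma vertex_rot d : vertex P (rot P d) = vertex P d.
Proof. by apply/mem_vertex_eq; rewrite inE fconnect1. Qed.

Lemma vertex_through d : vertex P (through P d) = vertex P d.
Proof. by apply/mem_vertex_eq; rewrite inE fconnect_through. Qed.

Lemma vertex_double d : (vertex P d \in double_points P) = (order (rot P)
  d == 4).
Proof.
apply/imsetP/idP => [[e]|o4]; last by exists d; rewrite ?inE.
rewrite inE => /eqP <- /eqP; rewrite eq_vertex => de;
  by rewrite (fconnect_order de).
Qed.

Lemma doubleP c : c \in double_points P ->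
  exists2 d, c = vertex P d & order (rot P) d = 4.
Proof. by case/imsetP=> d; rewrite inE => /eqP o4 ->; exists d. Qed.

Lemma double_mem c d : c \in double_points P -> d \in c ->
  c = vertex P d /\ order (rot P) d = 4.
Proof.
case/doubleP=> e -> o4 de; rewrite (mem_vertex_eq de); split=> //.
by rewrite -(@fconnect_order e) // -mem_vertex.
Qed.

Lemma card_double c : c \in double_points P -> #|c| = 4.
Proof.
by case/doubleP=> d -> <-; apply: eq_card => e; rewrite inE.
Qed.

(** One curve accounts for two cycles of the traversal, one per direction. *)
Lemma single_curve_fcard (d0 : D) : single_curve P -> fcard (trav P) D = 2.
Proof.
move=> scP; have syms := fconnect_sym trav_inj.
rewrite (n_compC (fconnect (trav P) d0)) (n_comp_connect syms).
rewrite (@eq_n_comp_r _ _ _ (fconnect (trav P) (opp P d0)))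
  ?(n_comp_connect syms) //.
move=> d; rewrite !inE; apply/idP/idP => [|od]; last first.
  apply/negP=> dd; have := trav_oppF d0; rewrite (connect_trans dd) //.
  by rewrite syms.
move=> nd; have := scP d0 d; rewrite (negPf nd) /=.
by rewrite -fconnect_trav_opp oppK.
Qed.

Lemma fcard_single_curve : fcard (trav P) D <= 2 -> single_curve P.
Proof.
move=> le2 d e; apply: contraLR le2; rewrite negb_or -ltnNge => /andP[nde ndoe].
rewrite (n_compC (fconnect (trav P) d)) (n_comp_connect (fconnect_sym
  trav_inj)).
rewrite add1n ltnS.
have cl : fclosed (trav P) [predC fconnect (trav P) d].
  by apply: predC_closed; apply: connect_closed; apply: fconnect_sym trav_inj.
apply/(fcard_gt1P trav_inj cl); exists e; rewrite ?inE // .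
by exists (opp P e); rewrite ?inE // trav_oppF.
Qed.

End WellFormed.

Definition orientation (D : finType) (P : diagram D) (O : pred D) :=
  (forall d, O (trav P d) = O d) /\ forall d, O (opp P d) = ~~ O d.

Section Orientation.

Variables (D : finType) (P : diagram D) (O : pred D).
Hypotheses (wfP : well_formed P) (orO : orientation P O).

Lemma orientation_through d : O (through P d) = ~~ O d.
Proof. by case: orO => tr op; rewrite -{1}[d](oppK wfP) -/(trav P _) tr op. Qed.

Lemma orientation_fconnect d e : fconnect (trav P) d e -> O d = O e.
Proof.
move/iter_findex <-; elim: (findex _ _ _) => //= n ->; by case: orO => ->.
Qed.

Lemma orientation_rot2 d : order (rot P) d = 4 -> O (rot P (rot P d)) = ~~ O d.
Proof. by move=> o4; rewrite -orientation_through /through o4. Qed.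

Lemma orientation_single : single_curve P -> forall d e,
  fconnect (trav P) d e = (O d == O e).
Proof.
move=> scP d e; apply/idP/eqP => [|Ode]; first exact: orientation_fconnect.
case/orP: (scP d e) => // /orientation_fconnect; rewrite Ode.
by case: orO => _ ->; case: (O e).
Qed.

(** Reversal turns connectedness along the orientation into connectedness
    against it. *)
Lemma orientation_connected :
  (forall d e, O d -> O e -> fconnect (trav P) d e) -> single_curve P.
Proof.
move=> conn d e; have [_ op] := orO.
case Od: (O d); case Oe: (O e).
- by rewrite conn.
- by rewrite (conn _ (opp P e)) ?orbT // op Oe.
- by rewrite -[X in _ || X](fconnect_trav_opp wfP) (oppK wfP) (conn (opp P d)
  e) ?orbT // op Od.
by rewrite -(fconnect_trav_opp wfP) conn // op ?Od ?Oe.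
Qed.

End Orientation.

Lemma single_orientation (D : finType) (P : diagram D) (d0 : D) :
  well_formed P -> single_curve P -> orientation P (fconnect (trav P) d0).
Proof.
move=> wfP scP; split=> d; first by rewrite -same_fconnect1_r //;
  apply: trav_inj.
have := scP d0 d; case dd: (fconnect _ d0 d) => /=; last by move=> ->.
move=> _.
apply/negP => od; have := trav_oppF wfP d.
by rewrite (connect_trans _ od) // fconnect_sym //; apply: trav_inj.
Qed.

(** * Splices as planar pairings of darts *)

(** A simultaneous choice, at each double point, of one of the two reconnections
    without a crossing. *)
Definition planar_pairing (D : finType) (P : diagram D) (g : D -> D) :=
  forall d, order (rot P) d = 4 ->
    g (g d) = d /\ (g d = rot P d \/ rot P (g d) = d).

(** Keeping the pairing g apart from the set T of spliced double points lets the
    two vary independently: subsets of a fixed choice of splices, and choices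
    made recursively, are all of this form. *)
Definition resolve (D : finType) (P : diagram D) (T : {set {set D}})
    (g : D -> D) : diagram D :=
  Diagram (opp P) (fun d => if vertex P d \in T then g d else rot P d).

Lemma splice_resolve (D : finType) (P : diagram D) (S N : {set {set D}}) :
  splice P S N = resolve P (S :|: N)
    (fun d => if vertex P d \in S then seifert_partner P d
              else nonseifert_partner P d).
Proof.
congr Diagram; apply: functional_extensionality => d; rewrite inE.
by case: (_ \in S).
Qed.

Lemma resolve_congr (D : finType) (P : diagram D) (T : {set {set D}})
  (g h : D -> D) :
  (forall d, vertex P d \in T -> g d = h d) -> resolve P T g = resolve P T h.
Proof.
move=> E; congr Diagram; apply: functional_extensionality => d.
by case: ifP => // /E.
Qed.

Section Resolve.

Variables (D : finType) (P : diagram D) (T : {set {set D}}) (g : D -> D).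
Hypotheses (wfP : well_formed P) (subT : T \subset double_points P).
Hypothesis pg : planar_pairing P g.

Let Q := resolve P T g.

Lemma order_double d : vertex P d \in T -> order (rot P) d = 4.
Proof. by move=> /(subsetP subT); rewrite vertex_double // => /eqP. Qed.

Lemma pairing_vertex d : order (rot P) d = 4 -> vertex P (g d) = vertex P d.
Proof.
by case/pg=> _ [-> | E]; rewrite -1?{2}E vertex_rot.
Qed.

Lemma pairing_neq d : order (rot P) d = 4 -> g d != d.
Proof.
move=> o4; have [_ u _] := rot4 wfP o4; have rd : rot P d != d.
  by move: u; rewrite /= !inE !negb_or (eq_sym _ d); case/andP=> /and3P[].
case: (pg o4) => _ [->//|]; apply: contra_eqN => /eqP ->; exact: rd.
Qed.

Lemma resolve_rot_in d : vertex P d \in T ->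
  rot Q d = g d /\ rot Q (g d) = d.
Proof.
move=> dT; have o4 := order_double dT; rewrite /= dT pairing_vertex // dT.
by have [-> _] := pg o4.
Qed.

Lemma resolve_in d e : vertex P d \in T ->
  fconnect (rot Q) d e = (e \in [:: d; g d]).
Proof.
move=> dT; have [E1 E2] := resolve_rot_in dT; rewrite !inE.
apply/idP/orP => [/iter_findex <-|[]/eqP->]; last by rewrite -E1 fconnect1.
  elim: (findex _ _ _) => [|n IH]; [by left | case: IH => /eqP].
    by move=> IH; right; rewrite iterS IH E1.
  by move=> IH; left; rewrite iterS IH E2.
exact: connect0.
Qed.

Lemma resolve_order_in d : vertex P d \in T -> order (rot Q) d = 2.
Proof.
move=> dT; have o4 := order_double dT; rewrite /order.
rewrite (eq_card (fun e => resolve_in e dT)).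
by apply/card_uniqP; rewrite /= inE eq_sym pairing_neq.
Qed.

Lemma resolve_out d : vertex P d \notin T ->
  fconnect (rot Q) d =1 fconnect (rot P) d.
Proof.
move=> dT; apply: fconnect_agree => e; rewrite -eq_vertex // => /eqP de /=.
by rewrite -de (negPf dT).
Qed.

Lemma resolve_order_out d : vertex P d \notin T ->
  order (rot Q) d = order (rot P) d.
Proof. by move=> dT; apply: eq_card; apply: resolve_out. Qed.

Lemma resolve_vertex_out d : vertex P d \notin T -> vertex Q d = vertex P d.
Proof. by move=> dT; apply/setP=> e; rewrite !inE resolve_out. Qed.

Lemma resolve_through_out d : vertex P d \notin T -> through Q d = through P d.
Proof.
move=> dT; rewrite /through resolve_order_out //= (negPf dT).
by rewrite vertex_rot // (negPf dT).
Qed.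

Lemma resolve_wf : well_formed Q.
Proof.
split; [exact: (oppK wfP)|exact: (opp_neq wfP)| |] => [d e|d].
  have stable u : (vertex P (rot Q u) \in T) = (vertex P u \in T).
    case uT: (vertex P u \in T); rewrite /= uT ?vertex_rot //.
    by rewrite pairing_vertex ?order_double.
  case dT: (vertex P d \in T); case eT: (vertex P e \in T) => E;
    have := stable d; rewrite E stable dT eT // => _.
    have [E1 E2] := resolve_rot_in dT; have [E3 E4] := resolve_rot_in eT.
    by rewrite -E2 -E4 -E1 -E3 E.
  by move: E; rewrite /= dT eT; apply: rot_inj.
case dT: (vertex P d \in T); first by rewrite resolve_order_in.
by rewrite resolve_order_out ?dT //; case: wfP.
Qed.

Lemma resolve_double_vertex d :
  (vertex Q d \in double_points Q) = (order (rot P) d == 4) &&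
    (vertex P d \notin T).
Proof.
rewrite vertex_double; last exact: resolve_wf.
case dT: (vertex P d \in T); first by rewrite resolve_order_in // andbF.
by rewrite resolve_order_out ?dT // andbT.
Qed.

Lemma resolve_double : double_points Q = double_points P :\: T.
Proof.
apply/setP=> c; rewrite inE; apply/idP/andP => [cQ|[cT /doubleP[]//]].
  have [d E o4] := doubleP cQ; move: cQ; rewrite E resolve_double_vertex.
  by case/andP=> o4P dT; rewrite resolve_vertex_out // vertex_double.
move=> d E o4; rewrite {c}E in cT *; rewrite -(resolve_vertex_out cT).
by rewrite resolve_double_vertex o4 eqxx.
Qed.

Lemma resolve_order4 d : order (rot Q) d = 4 ->
  order (rot P) d = 4 /\ vertex P d \notin T.
Proof.
case dT: (vertex P d \in T); first by rewrite resolve_order_in.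
by rewrite resolve_order_out ?dT.
Qed.

Lemma resolve_pairing h : planar_pairing P h -> planar_pairing Q h.
Proof.
move=> ph d /resolve_order4[o4 dT]; have [hK hd] := ph d o4; split=> //.
case: hd => hd; [left | right]; first by rewrite /= (negPf dT).
move: dT; rewrite -{1}hd vertex_rot //= => dT; by rewrite (negPf dT).
Qed.

Lemma resolve_comp (U : {set {set D}}) (h : D -> D) :
  U \subset double_points Q ->
  resolve Q U h =
  resolve P (T :|: U) (fun d => if vertex P d \in T then g d else h d).
Proof.
move=> subU; congr Diagram; apply: functional_extensionality => d;
  rewrite inE /=.
case dT: (vertex P d \in T) => /=; last by rewrite resolve_vertex_out ?dT.
case: ifP => // /(subsetP subU).
by rewrite resolve_double_vertex dT andbF.
Qed.

End Resolve.

Lemma resolve0 (D : finType) (P : diagram D) g : resolve P set0 g = P.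
Proof.
by case: P => o r; congr Diagram; apply: functional_extensionality => d;
  rewrite inE.
Qed.

(** Splicing joins the four darts in two neighbouring pairs; naming the first
    dart of one pair fixes the names a, b, c, e used below for all four. *)
Lemma pairing_start (D : finType) (P : diagram D) g c :
  well_formed P -> planar_pairing P g -> c \in double_points P ->
  exists a, [/\ c = vertex P a, order (rot P) a = 4 & g a = rot P a].
Proof.
move=> wfP pg /doubleP[d -> o4]; have [gK [gd|gd]] := pg d o4.
  by exists d.
exists (g d); rewrite gK gd (pairing_vertex wfP pg) //; split=> //.
by rewrite -{1}gd order_rot // in o4.
Qed.

Section OneSplice.

Variables (D : finType) (P : diagram D) (g : D -> D) (a : D).
Hypotheses (wfP : well_formed P) (pg : planar_pairing P g).
Hypotheses (o4 : order (rot P) a = 4) (ga : g a = rot P a).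

Let b := rot P a.
Let c := rot P b.
Let e := rot P c.
Let Q := resolve P [set vertex P a] g.

Lemma corners_uniq : uniq [:: a; b; c; e].
Proof. by case: (rot4 wfP o4). Qed.

Lemma corners_mem z : (vertex P z == vertex P a) = (z \in [:: a; b; c; e]).
Proof. by rewrite eq_sym eq_vertex //; case: (rot4 wfP o4). Qed.

Lemma corners_rot : rot P e = a.
Proof. by case: (rot4 wfP o4). Qed.

Lemma corners_order z : z \in [:: a; b; c; e] -> order (rot P) z = 4.
Proof.
by rewrite -corners_mem eq_vertex // => /(fconnect_order wfP) ->.
Qed.

Lemma corners_pairing : [/\ g a = b, g b = a, g c = e & g e = c].
Proof.
have [gaK _] := pg o4; rewrite ga -/b in gaK.
have oc : order (rot P) c = 4 by apply: corners_order; rewrite !inE eqxx !orbT.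
have [gcK gc] := pg oc.
have gcE : g c = e.
  case: gc => // /(rot_inj wfP) gc; move: gcK; rewrite gc gaK => E.
  by have := corners_uniq; rewrite /= !inE E eqxx !orbT.
by split=> //; rewrite -gcE.
Qed.

Lemma corners_through : [/\ through P a = c, through P b = e,
  through P c = a & through P e = b].
Proof.
have oP z : z \in [:: a; b; c; e] -> through P z = rot P (rot P z).
  by move=> /corners_order oz; rewrite /through oz.
by split; rewrite oP ?inE ?eqxx ?orbT //= ?corners_rot.
Qed.

Lemma corners_neq : [/\ [/\ a != b, a != c & a != e], [/\ b != c, b != e &
  c != e]
  & [/\ [/\ b != a, c != a & e != a], c != b & [/\ e != b & e != c]]].
Proof.
have := corners_uniq; rewrite /= !inE !negb_or andbT.
move=> /and3P[/and3P[ab ac ae] /andP[bc be] ce].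
by rewrite !(eq_sym b a) !(eq_sym c) !(eq_sym e); do !split.
Qed.

Let subc : [set vertex P a] \subset double_points P.
Proof. by rewrite sub1set vertex_double // o4. Qed.

Lemma one_splice_wf : well_formed Q.
Proof. exact: resolve_wf. Qed.

(** The 4-cycle (a b c e) becomes (a b)(c e), which costs one transposition; the
    face permutation follows, whereas the strands across the vertex change from
    ac, be to ab, ce, which costs two. *)
Lemma one_splice_rot : rot Q =1 rot P \o tperm b e.
Proof.
have [g1 g2 g3 g4] := corners_pairing.
have [[ab ac ae] [bc be ce] [[ba ca ea] cb [eb ec]]] := corners_neq.
move=> z /=; rewrite inE corners_mem; case: ifP => [|].
  rewrite !inE => /or4P[]/eqP->; rewrite ?tpermL ?tpermR ?g1 ?g2 ?g3 ?g4 //.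
  - by rewrite tpermD.
  - by rewrite corners_rot.
  by rewrite tpermD.
rewrite !inE => /negbT; rewrite !negb_or => /and4P[za zb zc ze].
by rewrite tpermD // eq_sym.
Qed.

Lemma one_splice_face : face Q =1 face P \o tperm (opp P b) (opp P e).
Proof.
move=> z; rewrite /face one_splice_rot /=; congr (rot P _).
case: (tpermP (opp P b) (opp P e) z) => [->|->|zb ze];
  rewrite ?oppK ?tpermL ?tpermR //.
by rewrite tpermD //; apply/eqP=> E; [apply: zb | apply: ze]; rewrite E oppK.
Qed.

Lemma one_splice_through : through Q =1 tperm a e \o (tperm b c \o through P).
Proof.
have [g1 g2 g3 g4] := corners_pairing.
have [[ab ac ae] [bc be ce] [[ba ca ea] cb [eb ec]]] := corners_neq.
have [t1 t2 t3 t4] := corners_through.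
move=> z; case cz: (z \in [:: a; b; c; e]).
  have vz : vertex P z \in [set vertex P a] by rewrite inE corners_mem.
  rewrite {1}/through (resolve_order_in wfP subc pg vz) /= vz.
  move: cz; rewrite !inE => /or4P[]/eqP-> ; rewrite ?t1 ?t2 ?t3 ?t4 ?g1 ?g2 ?g3
    ?g4.
  - by rewrite tpermR tpermD.
  - by rewrite (tpermD be ce) tpermR.
  - by rewrite (tpermD ba ca) tpermL.
  by rewrite tpermL tpermD.
have vz : vertex P z \notin [set vertex P a] by rewrite inE corners_mem cz.
rewrite (resolve_through_out _ wfP vz) /=.
have : through P z \notin [:: a; b; c; e].
  by rewrite -corners_mem vertex_through // corners_mem cz.
rewrite !inE !negb_or => /and4P[za zb zc ze].
by rewrite (@tpermD _ b c) 1?eq_sym // tpermD // eq_sym.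
Qed.

Lemma one_splice_trav : trav Q =1 tperm a e \o (tperm b c \o trav P).
Proof. by move=> z; rewrite /trav one_splice_through. Qed.

End OneSplice.

(** * The effect of one splice on vertices, faces and curves *)

Section StepCounts.

Variables (D : finType) (P : diagram D) (g : D -> D) (a : D).
Hypotheses (wfP : well_formed P) (pg : planar_pairing P g).
Hypotheses (o4 : order (rot P) a = 4) (ga : g a = rot P a).

Let b := rot P a.
Let c := rot P b.
Let e := rot P c.
Let Q := resolve P [set vertex P a] g.

Lemma fcard_rot_splice : fcard (rot Q) D = (fcard (rot P) D).+1.
Proof.
have [_ [_ be _] _] := corners_neq wfP o4.
rewrite (eq_fcard (one_splice_rot wfP pg o4 ga)).
have := fcard_comp_tperm (rot_inj wfP) be.
suff -> : fconnect (rot P) b e by rewrite addn0.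
by rewrite -2!(same_fconnect1_r (rot_inj wfP)) connect0.
Qed.

(** The splice (a b)(c e) joins the corner between e and a to the one between b
    and c. *)
Lemma fcard_face_splice :
  fcard (face Q) D + (~~ fconnect (face P) a c).*2 = (fcard (face P) D).+1.
Proof.
have [_ [_ be _] _] := corners_neq wfP o4.
rewrite (eq_fcard (one_splice_face wfP pg o4 ga)).
have nbe : opp P b != opp P e by rewrite (inj_eq (opp_inj wfP)).
have := fcard_comp_tperm (face_inj wfP) nbe.
rewrite (same_fconnect1 (face_inj wfP)) (same_fconnect1_r (face_inj wfP)).
by rewrite /face !oppK // (corners_rot wfP o4) fconnect_sym;
  last exact: face_inj.
Qed.

Lemma fcard_face_unsplice :
  fcard (face P) D + (~~ fconnect (face Q) (opp P b)
    (opp P e)).*2 = (fcard (face Q) D).+1.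
Proof.
have [_ [_ be _] _] := corners_neq wfP o4.
have nbe : opp P b != opp P e by rewrite (inj_eq (opp_inj wfP)).
have wfQ := one_splice_wf wfP pg o4.
have E : face P =1 face Q \o tperm (opp P b) (opp P e).
  by move=> z; have /= -> := one_splice_face wfP pg o4 ga (tperm (opp P b)
    (opp P e) z); rewrite tpermK.
rewrite (eq_fcard E); exact: (fcard_comp_tperm (face_inj wfQ) nbe).
Qed.

Section Orient.

Variable O : pred D.
Hypothesis orO : orientation P O.

Lemma corners_orient : O c = ~~ O a /\ O e = ~~ O b.
Proof.
have ob : order (rot P) b = 4 by rewrite order_rot.
by split; apply: orientation_rot2.
Qed.

Lemma corners_mirror x y : fconnect (trav P) x y = fconnect (trav P)
  (through P x) (through P y).
Proof.
rewrite -(fconnect_trav_opp wfP) (same_fconnect1 (trav_inj wfP)).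
by rewrite (same_fconnect1_r (trav_inj wfP)) /trav !oppK.
Qed.

Lemma not_fconnect x y : O x != O y -> ~~ fconnect (trav P) x y.
Proof. by apply: contraNN => /(orientation_fconnect orO) ->. Qed.

(** Each of the two transpositions acts on one direction of travel, and the two
    are mirror images; so the number of curves goes up by one if the strands
    were on the same curve, and down by one if not. *)
Lemma fcard_trav_seifert : O b = ~~ O a ->
  if fconnect (trav P) a e then
    fcard (trav Q) D = (fcard (trav P) D).+2 /\ ~~ fconnect (trav Q) a e
  else (fcard (trav Q) D).+2 = fcard (trav P) D.
Proof.
move=> Ob; have [Oc Oe] := corners_orient.
have [[ab ac ae] [bc be ce] _] := corners_neq wfP o4.
have [t1 t2 t3 t4] := corners_through wfP o4.
have EQ := one_splice_trav wfP pg o4 ga.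
have injf := trav_inj wfP; have injs := inj_tperm_comp injf (x := b) (y := c).
have F1 := fcard_tperm_comp injf bc; have F2 := fcard_tperm_comp injs ae.
have Eae : fconnect (trav P) b c = fconnect (trav P) a e.
  by rewrite [RHS]corners_mirror t1 t4 fconnect_sym.
have Eae' : fconnect (tperm b c \o trav P) a e = fconnect (trav P) a e.
  by rewrite fconnect_tperm_off //; apply: not_fconnect; rewrite ?Oc ?Ob;
    case: (O a).
rewrite Eae' in F2; rewrite Eae in F1; rewrite (eq_fcard EQ).
rewrite (eq_fconnect EQ) (fconnect_tperm_flip injs ae) Eae'.
move: F1 F2; move: (fcard (tperm a e \o _) D) (fcard (tperm b c \o _) D) => x y.
move: (fcard (trav P) D) => z.
by case: (fconnect _ a e) => /= F1 F2; first split=> //; clear -F1 F2; lia.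
Qed.

(** The first transposition joins the two directions of travel into one cycle,
    which the second cuts again. *)
Lemma fcard_trav_nonseifert : O b = O a -> fconnect (trav P) a b ->
  fcard (trav Q) D = fcard (trav P) D.
Proof.
move=> Ob con; have [Oc Oe] := corners_orient.
have [[ab ac ae] [bc be ce] _] := corners_neq wfP o4.
have [t1 t2 t3 t4] := corners_through wfP o4.
have EQ := one_splice_trav wfP pg o4 ga.
have injf := trav_inj wfP; have injs := inj_tperm_comp injf (x := b) (y := c).
have F1 := fcard_tperm_comp injf bc; have F2 := fcard_tperm_comp injs ae.
have nbc : ~~ fconnect (trav P) b c by apply: not_fconnect; rewrite Oc Ob;
  case: (O a).
have ba : fconnect (tperm b c \o trav P) b a.
  by apply: fconnect_tperm_merge => //; rewrite fconnect_sym // con.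
have be' : fconnect (tperm b c \o trav P) b e.
  apply: fconnect_tperm_merge => //; apply/orP; right.
  by rewrite corners_mirror t3 t4 con.
have ae' : fconnect (tperm b c \o trav P) a e.
  by rewrite (fconnect_sym injs) in ba; exact: connect_trans ba be'.
rewrite (eq_fcard EQ); move: F1 F2; rewrite ae' nbc /=.
move: (fcard (tperm a e \o _) D) (fcard (tperm b c \o _) D) => x y F1 F2;
  clear -F1 F2; lia.
Qed.

End Orient.
End StepCounts.

(** * Genus, parity and connectedness after several splices *)

(** A single curve is connected, so the Euler inequality applies to it. *)
Lemma single_euler (D : finType) (Q : diagram D) :
  well_formed Q -> single_curve Q ->
  fcard (rot Q) D + fcard (face Q) D <= fcard (opp Q) D + 2.
Proof.
move=> wfQ scQ.
apply: (connected_euler (oppK wfQ) (opp_neq wfQ) (rot_inj wfQ)) =>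
  col co cr d e.
have ct x : col (through Q x) = col x by rewrite /through; case: ifP;
  rewrite !cr.
have conn x y : fconnect (trav Q) x y -> col x = col y.
  by move/iter_findex <-; elim: (findex _ _ _) => //= n ->; rewrite /trav ct co.
by case/orP: (scQ d e) => /conn ->.
Qed.

Section ManySplices.

Variables (D : finType) (P : diagram D) (g : D -> D).
Hypotheses (wfP : well_formed P) (pg : planar_pairing P g).

Lemma resolve_add (T : {set {set D}}) c :
  T \subset double_points P -> c \in double_points P -> c \notin T ->
  c \in double_points (resolve P T g) /\
  resolve (resolve P T g) [set c] g = resolve P (c |: T) g.
Proof.
move=> subT cP cT; have cQ : c \in double_points (resolve P T g).
  by rewrite resolve_double // inE cT.
split=> //; rewrite resolve_comp // ?sub1set // setUC.
by apply: resolve_congr => d _; case: ifP.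
Qed.

(** Simultaneous splices may be performed one after the other. *)
Lemma resolve_ind (R : diagram D -> {set {set D}} -> Prop) :
  R P set0 ->
  (forall (T : {set {set D}}) c, T \subset double_points P ->
    c \in double_points P ->
     c \notin T -> c \in double_points (resolve P T g) ->
     R (resolve P T g) T ->
     R (resolve (resolve P T g) [set c] g) (c |: T)) ->
  forall T : {set {set D}}, T \subset double_points P -> R (resolve P T g) T.
Proof.
move=> R0 RS T; have [n] := ubnP #|T|; elim: n T => // n IH T.
have [-> _ _|[c cT]] := set_0Vmem T; first by rewrite resolve0.
rewrite (cardsD1 c) cT add1n ltnS => leT subT.
have cP := subsetP subT _ cT.
have subT' : T :\ c \subset double_points P by apply: subset_trans (subD1set _
  _) subT.
have cT' : c \notin T :\ c by rewrite !inE eqxx.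
have [cQ E] := resolve_add subT' cP cT'.
by have := RS _ _ subT' cP cT' cQ (IH _ leT subT'); rewrite E setD1K.
Qed.

(** Each splice adds one vertex and removes at most one face. *)
Lemma resolve_euler (T : {set {set D}}) : T \subset double_points P ->
  fcard (rot P) D + fcard (face P) D <=
  fcard (rot (resolve P T g)) D + fcard (face (resolve P T g)) D.
Proof.
move=> subT; apply: (resolve_ind (R := fun Q _ =>
  fcard (rot P) D + fcard (face P) D <= fcard (rot Q) D + fcard (face Q) D))
    subT => //.
move=> {}T c subT cP cT cQ; set Q := resolve P T g in cQ *.
have wfQ : well_formed Q by apply: resolve_wf.
have pQ : planar_pairing Q g by apply: resolve_pairing.
have [a [-> o4 ga]] := pairing_start wfQ pQ cQ => IH; apply: leq_trans IH _.
rewrite (fcard_rot_splice wfQ pQ o4 ga) addSnnS leq_add2l.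
rewrite -ltnS -(fcard_face_splice wfQ pQ o4 ga).
by case: (fconnect _ _ _); rewrite ?addn0 ?addn2 //; do 2!apply: leqW.
Qed.

Lemma resolve_orientation (T : {set {set D}}) (O : pred D) :
  T \subset double_points P -> orientation P O ->
  (forall d, vertex P d \in T -> O (g d) = ~~ O d) ->
  orientation (resolve P T g) O.
Proof.
move=> subT orO anti; split=> d; last by case: orO => _ ->.
have Eo : O d = ~~ O (opp P d) by case: orO => _ ->; rewrite negbK.
rewrite [RHS]Eo /trav /=.
case dT: (vertex P (opp P d) \in T).
  by rewrite /through (resolve_order_in wfP subT pg dT) /= dT anti.
by rewrite resolve_through_out ?dT // orientation_through.
Qed.

(** The number of curves changes by one at each Seifert splice and is one at
    both ends.  As fcard counts every curve twice, parity is read modulo 4. *)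
Lemma seifert_single_even (T : {set {set D}}) (O : pred D) :
  single_curve P -> T \subset double_points P -> orientation P O ->
  (forall d, vertex P d \in T -> O (g d) = ~~ O d) ->
  single_curve (resolve P T g) -> ~~ odd #|T|.
Proof.
have [->|[c0 cT0]] := set_0Vmem T; first by rewrite cards0.
move=> scP subT orO anti; have [d0 _ _] := doubleP (subsetP subT _ cT0).
move=> scQ; have E := single_curve_fcard (resolve_wf wfP subT pg) d0 scQ.
suff [k Ek] : exists k, fcard (trav (resolve P T g)) D + #|T|.*2 = 2 + 4 * k.
  by rewrite E in Ek; lia.
move: anti {E scQ}; apply: (resolve_ind (R := fun Q T =>
  (forall d, vertex P d \in T -> O (g d) = ~~ O d) ->
  exists k, fcard (trav Q) D + #|T|.*2 = 2 + 4 * k)) subT => [_|].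
  by exists 0; rewrite (single_curve_fcard wfP d0 scP) cards0.
move=> {cT0}T c subT cP cT cQ IH anti.
have antiT d : vertex P d \in T -> O (g d) = ~~ O d.
  by move=> dT; apply: anti; rewrite inE dT orbT.
have [k Ek] := IH antiT; set Q := resolve P T g in cQ Ek *.
have wfQ : well_formed Q by apply: resolve_wf.
have pQ : planar_pairing Q g by apply: resolve_pairing.
have orQ : orientation Q O by apply: resolve_orientation.
have [a [Ec o4 ga]] := pairing_start wfQ pQ cQ.
have [_ aT] := resolve_order4 wfP subT pg o4.
have Ec' : c = vertex P a by rewrite Ec resolve_vertex_out.
have Ob : O (rot Q a) = ~~ O a by rewrite -ga anti // Ec' setU11.
rewrite cardsU1 cT add1n doubleS Ec.
have := fcard_trav_seifert wfQ pQ o4 ga orQ Ob; move: Ek.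
move: (fcard (trav Q) D) (fcard (trav (resolve _ _ _)) D) #|T| => x y n Ek.
by case: ifP => _ [F]; [exists k.+1 | exists k]; clear -Ek F; lia.
Qed.

Lemma single_spherical (T : {set {set D}}) :
  spherical P -> T \subset double_points P ->
  single_curve (resolve P T g) -> spherical (resolve P T g).
Proof.
move=> sphP subT scQ; have ge2 := resolve_euler subT; rewrite sphP in ge2.
have wfQ : well_formed (resolve P T g) by apply: resolve_wf.
by apply/eqP; rewrite eqn_leq ge2 andbT; apply: single_euler.
Qed.

End ManySplices.

(** Two darts of a vertex with the same direction are a and its clockwise
    neighbour, or the darts facing them, which reversal relates to the
    former. *)
Lemma interlaced_corners (D : finType) (P : diagram D) (O : pred D) a p q :
  well_formed P -> orientation P O -> order (rot P) a = 4 -> O (rot P a)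
    = ~~ O a ->
  p \in vertex P a -> q \in vertex P a -> O p = O q ->
  ~~ fconnect (trav P) p q -> ~~ fconnect (trav P) a (rot P (rot P (rot P a))).
Proof.
move=> wfP orO o4 Ob; rewrite !mem_vertex; have [_ _ mem] := rot4 wfP o4.
have [Oc Oe] := corners_orient wfP o4 orO.
have [t1 t2 t3 t4] := corners_through wfP o4.
have syms := fconnect_sym (trav_inj wfP).
rewrite !mem !inE => /or4P[]/eqP-> /or4P[]/eqP->;
  rewrite ?connect0 ?Oc ?Oe ?Ob ?negbK //; try by case: (O a).
- by rewrite (corners_mirror wfP) t2 t3 syms.
- by rewrite (corners_mirror wfP) t2 t3.
by rewrite syms.
Qed.

Section Curves.

Variables (D : finType) (P : diagram D) (g : D -> D) (O : pred D).
Hypotheses (wfP : well_formed P) (pg : planar_pairing P g).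
Hypothesis (orO : orientation P O).

Lemma nonseifert_single c : single_curve P -> c \in double_points P ->
  (forall d, d \in c -> O (g d) = O d) -> single_curve (resolve P [set c] g).
Proof.
move=> scP cP co; have [a [Ec o4 ga]] := pairing_start wfP pg cP.
have sub1 : [set c] \subset double_points P by rewrite sub1set.
apply: fcard_single_curve; first exact: resolve_wf.
have Ob : O (rot P a) = O a by rewrite -ga co // Ec vertex_id.
rewrite Ec (fcard_trav_nonseifert wfP pg o4 ga orO) //.
  by rewrite (single_curve_fcard wfP a).
by rewrite (orientation_single orO scP) Ob.
Qed.

(** The first Seifert splice separates the curve at c, and the second joins the
    pieces again because v has one strand on each. *)
Lemma interlaced_single c v p q : single_curve P ->
  c \in double_points P -> v \in double_points P -> v != c ->
  (forall d, d \in c -> O (g d) = ~~ O d) ->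
  (forall d, d \in v -> O (g d) = ~~ O d) ->
  p \in v -> q \in v -> O p = O q ->
  ~~ fconnect (trav (resolve P [set c] g)) p q ->
  single_curve (resolve P [set v; c] g).
Proof.
move=> scP cP vP vc ac av pv qv Opq npq; set Q := resolve P [set c] g in npq.
have sub1 : [set c] \subset double_points P by rewrite sub1set.
have wfQ : well_formed Q by apply: resolve_wf.
have pQ : planar_pairing Q g by apply: resolve_pairing.
have vc' : v \notin [set c] by rewrite inE.
have [vQ ER] := resolve_add wfP pg sub1 vP vc'.
have inc d : vertex P d \in [set c] -> d \in c.
  by rewrite inE => /eqP <-; apply: vertex_id.
have orQ : orientation Q O by apply: resolve_orientation => // d /inc /ac.
rewrite -ER; have [a' [Ev o4' ga']] := pairing_start wfQ pQ vQ.
apply: fcard_single_curve; first by apply: resolve_wf; rewrite ?sub1set.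
have Ob' : O (rot Q a') = ~~ O a' by rewrite -ga' av // Ev vertex_id.
have := fcard_trav_seifert wfQ pQ o4' ga' orQ Ob'.
rewrite ifN; last first.
  by apply: (interlaced_corners wfQ orQ o4' Ob' _ _ Opq npq); rewrite -Ev.
rewrite -Ev; have [a [Ec o4 ga]] := pairing_start wfP pg cP.
have Ob : O (rot P a) = ~~ O a by rewrite -ga ac // Ec vertex_id.
have := fcard_trav_seifert wfP pg o4 ga orO Ob; rewrite -Ec -/Q.
rewrite (orientation_single orO scP).
have [_ ->] := corners_orient wfP o4 orO; rewrite Ob negbK eqxx => -[-> _].
by rewrite (single_curve_fcard wfP a) // => -[->].
Qed.

End Curves.

(** * Interlaced and nugatory double points *)

(** When Q is the Seifert splice of a single curve at c, this says that the
    chords of c and v cross in the Gauss diagram. *)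
Definition interlaced_after (D : finType) (Q : diagram D) (O : pred D)
  (v : {set D}) :=
  exists p q, [/\ p \in v, q \in v, O p, O q & ~~ fconnect (trav Q) p q].

(** Let X be the set of darts on the curve of a after the splice.  If no vertex
    has a strand on each curve, X is a union of components, so the faces on the
    two sides of the splice are different afterwards; undoing the splice merges
    them, which means that the two corners at c were in one face of P. *)
Lemma nugatory_or_interlaced (D : finType) (P : diagram D) g O c :
  well_formed P -> planar_pairing P g -> orientation P O -> single_curve P ->
  c \in double_points P -> (forall d, d \in c -> O (g d) = ~~ O d) ->
  nugatory P c \/ exists v, [/\ v \in double_points P, v != c
    & interlaced_after (resolve P [set c] g) O v].
Proof.
move=> wfP pg orO scP cP anti; set Q := resolve P [set c] g.
have sub1 : [set c] \subset double_points P by rewrite sub1set.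
have [a [Ec o4 ga]] := pairing_start wfP pg cP.
have Ob : O (rot P a) = ~~ O a by rewrite -ga anti // Ec vertex_id.
have [Oc Oe] := corners_orient wfP o4 orO; rewrite Ob negbK in Oe.
have wfQ : well_formed Q by apply: resolve_wf.
have orQ : orientation Q O.
  by apply: resolve_orientation => // d; rewrite inE => /eqP Ed;
    rewrite anti // -Ed vertex_id.
have := fcard_trav_seifert wfP pg o4 ga orO Ob; rewrite -Ec -/Q.
rewrite (orientation_single orO scP) Oe eqxx => -[_ nae].
have injQ := trav_inj wfQ.
(* Both directions of travel along the curve of a. *)
pose X d := fconnect (trav Q) a d || fconnect (trav Q) a (opp P d).
have Xopp d : X (opp P d) = X d by rewrite /X oppK // orbC.
have Xtrav d : X (trav Q d) = X d.
  rewrite /X -(same_fconnect1_r injQ); congr (_ || _).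
  rewrite [LHS](same_fconnect1_r injQ); congr (fconnect _ a _);
    exact: (trav_opp_trav wfQ d).
have Xthrough d : X (through Q d) = X d.
  by rewrite -[d in LHS](oppK wfP) -/(trav Q (opp P d)) Xtrav Xopp.
have Xconn d e : fconnect (trav Q) d e -> X d = X e.
  by move=> /iter_findex <-; elim: (findex _ _ _) => //= n ->; rewrite Xtrav.
have [closedX | openX] := altP (@forallP _ (fun d => X d ==> X (rot Q d))).
  left; split=> //; exists a; first by rewrite Ec vertex_id.
  have Xrot d : X d -> X (rot Q d) by apply/implyP.
  have Xa : X a by rewrite /X connect0.
  have := fcard_face_unsplice wfP pg o4 ga; have :=
    fcard_face_splice wfP pg o4 ga.
  rewrite -Ec -/Q; set b := rot P a; set e := rot P (rot P b).
  have -> : fconnect (face Q) (opp P b) (opp P e) = false.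
    apply/negP => be; have Xface d : X d -> X (face Q d).
      by move=> Xd; apply: Xrot; rewrite Xopp.
    have Xb : X (opp P b).
      have := Xrot _ Xa; rewrite Xopp /= -Ec inE eqxx; by rewrite ga.
    have : X (opp P e).
      by move: be => /iter_findex <-; elim: (findex _ _ _) => //= n;
        apply: Xface.
    rewrite Xopp /X (negPf nae) /= => /(orientation_fconnect orQ).
    by have [_ ->] := orO; rewrite /e /b Oe; case: (O a).
  case: (fconnect _ a _) => //=.
  by move: (fcard (face P) D) (fcard (face Q) D) => x y; clear; lia.
have [d] : exists d, ~~ (X d ==> X (rot Q d)) by apply/existsP;
  rewrite -negb_forall.
rewrite negb_imply => /andP[Xd nXd]; right.
have [o4d|o2] := eqVneq (order (rot Q) d) 4; last first.
  by case/negP: nXd; move: (Xthrough d); rewrite /through (negPf o2) => ->.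
have [o4P dT] := resolve_order4 wfP sub1 pg o4d.
exists (vertex P d); split; [by rewrite vertex_double // o4P| by rewrite inE in
  dT |].
have Er : rot Q d = rot P d by rewrite /= (negPf dT).
(* One of the two darts of each strand of this vertex is outgoing. *)
pose pick x := if O x then x else through P x.
have Op x : O (pick x).
  rewrite /pick; case: ifP => // /negbT; by rewrite -(orientation_through wfP
    orO).
have Vp x : vertex P (pick x) = vertex P x.
  by rewrite /pick; case: ifP => // _; rewrite vertex_through.
have Xp x : vertex P x = vertex P d -> X (pick x) = X x.
  move=> Ex; rewrite /pick; case: ifP => // _.
  by rewrite -(resolve_through_out g wfP (T := [set c])) ?Xthrough // Ex.
exists (pick d), (pick (rot P d)); split=> //.
- by rewrite -(Vp d) vertex_id.
- by rewrite -(vertex_rot wfP d) -(Vp (rot P d)) vertex_id.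
apply: contra nXd => /Xconn; rewrite Er !Xp ?vertex_rot // => <-; exact: Xd.
Qed.

Lemma fcard_involution (D : finType) (f : D -> D) :
  involutive f -> (forall d, f d != d) -> fcard f D * 2 = #|D|.
Proof.
move=> fK fN; apply: fcard_order_set => //; first exact: can_inj fK.
apply/subsetP=> d _; rewrite inE /order.
rewrite (@eq_card _ _ (mem [:: d; f d])) => [|e].
  by apply/eqP/card_uniqP; rewrite /= inE eq_sym fN.
by rewrite !inE fconnect_involution.
Qed.

(** Otherwise consider the last splice.  The result is a single circle, with a
    face on each side, and undoing a Seifert splice merges these two faces; the
    diagram before that splice would have only one face, which V + F - E >= 2
    excludes. *)
Lemma all_seifert_not_single (D : finType) (P : diagram D) g O :
  well_formed P -> planar_pairing P g -> orientation P O -> spherical P ->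
  double_points P != set0 ->
  (forall d, order (rot P) d = 4 -> O (g d) = ~~ O d) ->
  ~ single_curve (resolve P (double_points P) g).
Proof.
move=> wfP pg orO sphP /set0Pn[c cP] anti scD.
pose T := double_points P :\ c.
have subT : T \subset double_points P by apply: subD1set.
have cT : c \notin T by rewrite !inE eqxx.
set Q := resolve P T g; pose R := resolve Q [set c] g.
have [cQ] := resolve_add wfP pg subT cP cT; rewrite setD1K // -/Q -/R => ER.
have scR : single_curve R by rewrite ER.
have wfQ : well_formed Q by apply: resolve_wf.
have pQ : planar_pairing Q g by apply: resolve_pairing.
have wfR : well_formed R by apply: resolve_wf; rewrite ?sub1set.
have [a [Ec o4 ga]] := pairing_start wfQ pQ cQ.
have o2 d : order (rot R) d != 4.
  apply/eqP; rewrite ER => /(resolve_order4 wfP (subxx _) pg)[oP].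
  by rewrite vertex_double // oP.
have FR : fcard (face R) D = 2.
  rewrite -(single_curve_fcard wfR a scR); apply: eq_fcard => d.
  by rewrite /trav /through (negPf (o2 _)).
have VR : fcard (rot R) D = fcard (opp P) D.
  have : fcard (rot R) D * 2 = fcard (opp P) D * 2.
    rewrite !fcard_involution //; [exact: (oppK wfP)|exact: (opp_neq wfP)| |].
      by move=> d; case: (rot2 wfR (o2 d)).
    by move=> d; case: (rot2 wfR (o2 d)).
  by clear; lia.
have orR : orientation R O.
  by rewrite ER; apply: resolve_orientation => // d;
    rewrite vertex_double // => /eqP/anti.
have ge2 := resolve_euler wfP pg subT; rewrite sphP -/Q in ge2.
have := fcard_face_unsplice wfQ pQ o4 ga; rewrite -Ec -/R FR.
have V := fcard_rot_splice wfQ pQ o4 ga; rewrite -Ec -/R VR in V.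
have faceR : face R =1 trav R.
  by move=> d; rewrite /trav /through (negPf (o2 _)).
have orQ : orientation Q O.
  apply: resolve_orientation => // d; rewrite inE => /andP[_].
  by rewrite vertex_double // => /eqP/anti.
have [_ Oe] := corners_orient wfQ o4 orQ.
rewrite (eq_fconnect faceR).
rewrite (not_fconnect orR); last first.
  by have [_ op] := orQ; rewrite !op Oe; case: (O (rot Q a)).
move: V ge2; move: (fcard (opp P) D) (fcard (rot Q) D) (fcard (face Q) D) =>
  x y z.
by clear; lia.
Qed.

(** * Existence and comparison of the reductivities *)

(** Whether a reconnection respects an orientation can be read at any of the
    four darts. *)
Lemma pairing_kind (D : finType) (P : diagram D) g O d e :
  well_formed P -> planar_pairing P g -> orientation P O ->
  order (rot P) d = 4 -> e \in vertex P d -> (O (g e) == O e) = (O (g d)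
    == O d).
Proof.
move=> wfP pg orO o4 ed; have dP : vertex P d \in double_points P by rewrite
  vertex_double // o4.
have [a [Ea oa ga]] := pairing_start wfP pg dP.
have [g1 g2 g3 g4] := corners_pairing wfP pg oa ga.
have [Oc Oe] := corners_orient wfP oa orO.
have kind z : z \in vertex P a -> (O (g z) == O z) = (O (rot P a) == O a).
  rewrite mem_vertex; case: (rot4 wfP oa) => _ _ ->.
  rewrite !inE => /or4P[]/eqP->; rewrite ?g1 ?g2 ?g3 ?g4 ?Oc ?Oe;
    by case: (O a) (O (rot P a)) => [] [].
by rewrite !kind // -Ea // vertex_id.
Qed.

Section Partners.

Variables (D : finType) (P : diagram D) (O : pred D).
Hypotheses (wfP : well_formed P) (scP : single_curve P) (orO : orientation P O).

Lemma orientation_rot3 d : order (rot P) d = 4 -> O (iter 3 (rot P) d)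
  = ~~ O (rot P d).
Proof. by move=> o4; rewrite -(orientation_rot2 wfP orO) ?order_rot. Qed.

Lemma codirectedE d e : codirected P d e = (O d == O e).
Proof. exact: orientation_single. Qed.

Lemma orientation_seifert d : order (rot P) d = 4 ->
  O (seifert_partner P d) = ~~ O d.
Proof.
move=> o4; rewrite /seifert_partner codirectedE.
case: eqP => [E|/eqP]; first by rewrite orientation_rot3 // E.
by case: (O d) (O (rot P d)) => [] [].
Qed.

Lemma orientation_nonseifert d : order (rot P) d = 4 ->
  O (nonseifert_partner P d) = O d.
Proof.
move=> o4; rewrite /nonseifert_partner codirectedE.
case: eqP => [E|/eqP]; first by rewrite E.
by rewrite orientation_rot3 //; case: (O d) (O (rot P d)) => [] [].
Qed.

(** A planar reconnection is given by choosing, alternately around the vertex,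
    the clockwise and the counterclockwise neighbour. *)
Lemma alternating_pairing (k : pred D) :
  (forall d, order (rot P) d = 4 -> k (rot P d) = ~~ k d) ->
  planar_pairing P (fun d => if k d then iter 3 (rot P) d else rot P d).
Proof.
move=> kr d o4; have [r4 _ _] := rot4 wfP o4.
have k3 : k (iter 3 (rot P) d) = ~~ k d.
  by rewrite /= !kr ?order_rot // negbK.
case kd: (k d).
  by rewrite k3 kd /= r4; split=> //; right.
by rewrite kr // kd /= r4; split=> //; left.
Qed.

Lemma codirected_rot d : order (rot P) d = 4 ->
  codirected P (rot P d) (rot P (rot P d)) = ~~ codirected P d (rot P d).
Proof.
move=> o4; rewrite !codirectedE (orientation_rot2 wfP orO o4).
by case: (O d) (O (rot P d)) => [] [].
Qed.

Lemma seifert_pairing : planar_pairing P (seifert_partner P).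
Proof. exact: alternating_pairing codirected_rot. Qed.

Lemma nonseifert_pairing : planar_pairing P (nonseifert_partner P).
Proof.
have := @alternating_pairing (fun d => ~~ codirected P d (rot P d)).
have -> : (fun d => if ~~ codirected P d (rot P d) then iter 3 (rot P)
  d else rot P d)
  = nonseifert_partner P.
  by apply: functional_extensionality => d; rewrite if_neg.
by apply=> d o4; rewrite codirected_rot.
Qed.

Lemma pairing_partner (g : D -> D) d : planar_pairing P g -> order (rot P)
  d = 4 ->
  g d = if O (g d) == O d then nonseifert_partner P d else seifert_partner P d.
Proof.
move=> pg o4; have rot3 e : rot P e = d -> e = iter 3 (rot P) d.
  by have [r4 _ _] := rot4 wfP o4; rewrite -{1}r4 => /(rot_inj wfP).
have O3 := orientation_rot3 o4.
rewrite /nonseifert_partner /seifert_partner codirectedE.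
case: (pg d o4) => _ [->|/rot3->]; rewrite ?O3 (eq_sym (O d)).
  by case: eqP.
by case: (O d) (O (rot P d)) => [] [].
Qed.

End Partners.

Lemma resolve_union (D : finType) (P : diagram D) (T U : {set {set D}}) g :
  well_formed P -> planar_pairing P g -> T \subset double_points P ->
  U \subset double_points (resolve P T g) ->
  resolve (resolve P T g) U g = resolve P (T :|: U) g.
Proof.
move=> wfP pg subT subU; rewrite resolve_comp //.
by apply: resolve_congr => d _; case: ifP.
Qed.

Section MarkedProjections.

Variables (D : finType) (P : diagram D).
Hypothesis mkP : marked_knot_projection P.

Lemma marked_start : exists d0 : D, vertex P d0 \in double_points P.
Proof.
by case: mkP => _ _ _ /set0Pn[c cP]; have [d E _] := doubleP cP; exists d;
  rewrite -E.
Qed.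

Lemma resolve_marked (T : {set {set D}}) (g : D -> D) : planar_pairing P g ->
  T \proper double_points P ->
  single_curve (resolve P T g) -> marked_knot_projection (resolve P T g).
Proof.
case: mkP => wfP scP sphP dpP pg prT scQ; have subT := proper_sub prT.
split=> //; [exact: resolve_wf|exact: single_spherical|].
by rewrite resolve_double // setD_eq0 proper_subn.
Qed.

Lemma interlaced_exists O g c : orientation P O -> planar_pairing P g ->
  ~ reducible P ->
  c \in double_points P -> (forall d, d \in c -> O (g d) = ~~ O d) ->
  exists v, [/\ v \in double_points P, v != c
    & interlaced_after (resolve P [set c] g) O v].
Proof.
case: (mkP) => wfP scP _ _ orO pg irr cP anti.
have [nug|//] := nugatory_or_interlaced wfP pg orO scP cP anti.
by case: irr; split=> //; exists c.
Qed.

Lemma set1_proper_double c : ~ reducible P -> c \in double_points P ->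
  [set c] \proper double_points P.
Proof.
case: (mkP) => wfP scP _ _ irr cP; have [d0 _] := marked_start.
have orO := single_orientation d0 wfP scP.
have anti d : d \in c -> fconnect (trav P) d0 (seifert_partner P d)
  = ~~ fconnect (trav P) d0 d.
  by move=> dc; have [_ o4] := double_mem wfP cP dc;
    rewrite (orientation_seifert wfP scP orO).
have [v [vP vc _]] := interlaced_exists orO (seifert_pairing wfP scP orO)
  irr cP anti.
rewrite properE sub1set cP; apply/subsetPn; exists v => //.
by rewrite inE.
Qed.

End MarkedProjections.

(** Induction on the number of double points: a double point where g is
    non-Seifert for the current curve can be spliced, as one other double point
    remains; if there is none, two interlaced double points are spliced
    together, and some double point remains by [all_seifert_not_single]. *)
Lemma reducible_resolution (D : finType) (P : diagram D) g :
  marked_knot_projection P -> planar_pairing P g ->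
  exists2 T : {set {set D}}, T \subset double_points P &
    reducible (resolve P T g).
Proof.
have [n] := ubnP #|double_points P|; elim: n P => // n IH P le_n mkP pg.
have [redP | irr] := classic (reducible P).
  by exists set0; rewrite ?sub0set // resolve0.
case: (mkP) => wfP scP sphP dpP; have [d0 d0P] := marked_start mkP.
have orO := single_orientation d0 wfP scP.
set O := (X in orientation P X) in orO.
have step (T : {set {set D}}) : T != set0 -> T \proper double_points P ->
    single_curve (resolve P T g) ->
    exists2 T : {set {set D}}, T \subset double_points P &
      reducible (resolve P T g).
  move=> T0 prT scQ; have subT := proper_sub prT.
  have mkQ := resolve_marked mkP pg prT scQ.
  have pQ := resolve_pairing wfP subT pg pg.
  have [|U subU red] := IH (resolve P T g) _ mkQ pQ.
    rewrite resolve_double // -ltnS (leq_trans _ le_n) // ltnS.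
    rewrite cardsD (setIidPr subT) ltn_subrL card_gt0 T0 card_gt0.
    by apply/set0Pn; exists (vertex P d0).
  exists (T :|: U); last by rewrite -resolve_union.
  rewrite subUset subT; apply: subset_trans subU _.
  by rewrite resolve_double // subsetDl.
have [/existsP[d /andP[/eqP o4 Od]]|] :=
  boolP [exists d, (order (rot P) d == 4) && (O (g d) == O d)].
  have cP : vertex P d \in double_points P by rewrite vertex_double // o4.
  apply: (step [set vertex P d]); first by apply/set0Pn; exists (vertex P d);
    rewrite set11.
    exact: set1_proper_double.
  apply: (nonseifert_single wfP pg orO) => // e ed.
  by apply/eqP; rewrite (pairing_kind wfP pg orO o4 ed).
rewrite negb_exists => /forallP all_anti.
have anti d : order (rot P) d = 4 -> O (g d) = ~~ O d.
  move=> o4; have := all_anti d; rewrite o4 eqxx /=.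
  by case: (O (g d)) (O d) => [] [].
have antic c d : c \in double_points P -> d \in c -> O (g d) = ~~ O d.
  by move=> cP dc; have [_ /anti] := double_mem wfP cP dc.
set c := vertex P d0 in d0P.
have [v [vP vc [p [q [pv qv Op Oq npq]]]]] :=
  interlaced_exists mkP orO pg irr d0P (antic _ ^~ d0P).
have scQ : single_curve (resolve P [set v; c] g).
  apply: (interlaced_single wfP pg orO scP d0P vP vc _ _ pv qv _ npq).
  - by move=> d; apply: antic.
  - by move=> d; apply: antic.
  by rewrite Op Oq.
apply: (step _ _ _ scQ); first by apply/set0Pn; exists v; rewrite !inE eqxx.
rewrite properEneq subUset !sub1set vP d0P !andbT; apply/eqP => E.
by apply: (all_seifert_not_single wfP pg orO sphP dpP anti); rewrite -E.
Qed.

Lemma splice_nonseifert (D : finType) (P : diagram D) (N : {set {set D}}) :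
  splice P set0 N = resolve P N (nonseifert_partner P).
Proof.
by rewrite splice_resolve set0U; apply: resolve_congr => d _; rewrite inE.
Qed.

Lemma splice_seifert (D : finType) (P : diagram D) (S : {set {set D}}) :
  splice P S set0 = resolve P S (seifert_partner P).
Proof.
by rewrite splice_resolve setU0; apply: resolve_congr => d ->.
Qed.

Lemma splice_nonseifert_single (D : finType) (P : diagram D) c :
  well_formed P -> single_curve P -> c \in double_points P ->
  single_curve (splice P set0 [set c]).
Proof.
move=> wfP scP cP; have [d0 _ _] := doubleP cP; have orO :=
  single_orientation d0 wfP scP.
rewrite splice_nonseifert; apply: (nonseifert_single wfP (nonseifert_pairing
  wfP scP orO) orO) => // d dc.
have [_ o4] := double_mem wfP cP dc; exact: (orientation_nonseifert wfP scP
  orO).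
Qed.

(** An irreducible curve has at least two double points, so there is one left to
    continue with after a non-Seifert splice. *)
Lemma reducible_after_exists (D : finType) (P : diagram D) :
  marked_knot_projection P -> exists k, reducible_after k P.
Proof.
have [n] := ubnP #|double_points P|; elim: n P => // n IH P le_n mkP.
have [redP | irr] := classic (reducible P); first by exists 0.
case: (mkP) => wfP scP sphP dpP; have [d0 d0P] := marked_start mkP.
have orO := single_orientation d0 wfP scP.
have pg := nonseifert_pairing wfP scP orO.
have scQ := splice_nonseifert_single wfP scP d0P.
have prT := set1_proper_double mkP irr d0P.
have mkQ := resolve_marked mkP pg prT; rewrite -splice_nonseifert in mkQ.
have [|k red] := IH _ _ (mkQ scQ); last by exists k.+1; exists (vertex P d0).
rewrite splice_nonseifert resolve_double ?proper_sub // -ltnS (leq_trans _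
  le_n) // ltnS.
by rewrite [X in _ < X](cardsD1 (vertex P d0)) d0P.
Qed.

(** The reconnections used along a recursion, Seifert or not with respect to P,
    are collected into one pairing of the darts of P. *)
Lemma reducible_after_resolve (D : finType) (P : diagram D)
  k (T : {set {set D}}) g :
  well_formed P -> planar_pairing P g -> T \subset double_points P ->
  single_curve (resolve P T g) -> reducible_after k (resolve P T g) ->
  exists (T' : {set {set D}}) g', [/\ planar_pairing P g',
    T' \subset double_points P,
     #|T'| = #|T| + k & reducible (resolve P T' g')].
Proof.
move=> wfP; elim: k T g => [|k IH] T g pg subT scQ /=.
  by exists T, g; rewrite addn0.
set Q := resolve P T g in scQ * => -[c cQ].
have wfQ : well_formed Q by apply: resolve_wf.
have [d0 _ _] := doubleP cQ; have orO := single_orientation d0 wfQ scQ.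
have sc' := splice_nonseifert_single wfQ scQ cQ; move: sc'.
rewrite splice_nonseifert resolve_comp ?sub1set //.
set h := nonseifert_partner Q; set g' := fun d => _ => sc' red.
have ph : planar_pairing Q h := nonseifert_pairing wfQ scQ orO.
have pg' : planar_pairing P g'.
  move=> d o4; rewrite /g'; case dT: (vertex P d \in T).
    by have [gK gd] := pg d o4; rewrite (pairing_vertex wfP pg) // dT.
  have o4Q : order (rot Q) d = 4 by rewrite resolve_order_out ?dT.
  have [hK hd] := ph d o4Q; have Eh : vertex P (h d) = vertex P d.
    apply: (mem_vertex_eq wfP).
    by rewrite -(resolve_vertex_out g wfP (negbT dT))
      -(pairing_vertex wfQ ph o4Q) vertex_id.
  rewrite Eh dT hK; split=> //.
  by move: hd; rewrite /= Eh dT.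
have subT' : T :|: [set c] \subset double_points P.
  by move: cQ; rewrite resolve_double // subUset subT sub1set inE => /andP[].
have [T' [g2 [pg2 sub2 card2 red2]]] := IH _ _ pg' subT' sc' red.
exists T', g2; split=> //; rewrite card2 setUC cardsU1.
by move: cQ; rewrite resolve_double // inE => /andP[-> _];
  rewrite add1n addSnnS.
Qed.

(** A planar reconnection at a double point is one of its two splices. *)
Lemma resolve_splice (D : finType) (P : diagram D) (T : {set {set D}}) g :
  well_formed P -> single_curve P -> planar_pairing P g ->
    T \subset double_points P ->
  exists S N : {set {set D}}, [/\ S \subset double_points P,
    N \subset double_points P,
    [disjoint S & N], #|S| + #|N| = #|T| & splice P S N = resolve P T g].
Proof.
move=> wfP scP pg subT.
have [->|[c0 /(subsetP subT) cP]] := set_0Vmem T.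
  exists set0, set0; rewrite sub0set cards0 -setI_eq0 set0I eqxx; split=> //.
  by rewrite splice_resolve setU0 !resolve0.
have [d0 _ _] := doubleP cP; have orO := single_orientation d0 wfP scP.
set O := (X in orientation P X) in orO.
pose S := [set v in T | [forall d in v, O (g d) != O d]].
have subS : S \subset T by apply/subsetP=> v; rewrite inE => /andP[].
exists S, (T :\: S); split.
- exact: subset_trans subT.
- by apply: subset_trans subT; apply: subsetDl.
- by rewrite disjoints_subset; apply/subsetP => v vS;
  rewrite in_setC in_setD vS.
- by rewrite cardsD (setIidPr subS) subnKC // subset_leq_card.
have ET : S :|: (T :\: S) = T.
  by apply/setP=> v; rewrite in_setU in_setD; case: (boolP (v \in S)) =>
    // /(subsetP subS) ->.
rewrite splice_resolve ET.
apply: resolve_congr => d dT; have o4 := order_double wfP subT dT.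
rewrite (pairing_partner wfP scP orO pg o4) inE dT /=.
case: eqP => E; first by rewrite ifN //; apply/forallP=> /(_ d);
  rewrite vertex_id E eqxx.
rewrite ifT //; apply/forallP=> e; apply/implyP=> ed.
by rewrite (pairing_kind wfP pg orO o4 ed); apply/eqP.
Qed.

Lemma least_exists (A : nat -> Prop) : (exists n, A n) -> exists n, least A n.
Proof.
case=> n; have [k] := ubnP n; elim: k n => // k IH n le_nk An.
have [[m [Am lt_mn]]|no] := classic (exists m, A m /\ m < n).
  by apply: (IH m) => //; apply: leq_trans lt_mn _.
exists n; split=> // m Am; rewrite leqNgt; apply/negP => lt_mn.
by apply: no; exists m.
Qed.

Lemma reduced_not_reducible (D : finType) (P : diagram D) :
  reduced P -> ~ reducible P.
Proof. by case=> _ nn [_ nug]; apply: nn. Qed.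

Section Reductivities.

Variables (D : finType) (P : diagram D).
Hypothesis redP : reduced P.

Let mkP : marked_knot_projection P. Proof. by case: redP => -[]. Qed.
Let wfP : well_formed P. Proof. by case: mkP. Qed.
Let scP : single_curve P. Proof. by case: mkP. Qed.

Lemma reductivities_exist : exists t r y i : nat,
  [/\ is_t P t, is_r P r, is_y P y & is_i P i].
Proof.
have [d0 _] := marked_start mkP; have orO := single_orientation d0 wfP scP.
have [S subS redS] := reducible_resolution mkP (seifert_pairing wfP scP orO).
have [N subN redN] := reducible_resolution mkP (nonseifert_pairing wfP scP orO).
have [k redk] := reducible_after_exists mkP.
have [r r_least] := least_exists (ex_intro (fun k => reducible_after k P)
  k redk).
have [|i i_least] := @least_exists (fun k => exists S : {set {set D}},
    [/\ S \subset double_points P, #|S| = k & reducible (splice P S set0)]).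
  by exists #|S|, S; rewrite splice_seifert.
have [|y y_least] := @least_exists (fun k => exists N : {set {set D}},
    [/\ N \subset double_points P, #|N| = k & reducible (splice P set0 N)]).
  by exists #|N|, N; rewrite splice_nonseifert.
have [|t t_least] := @least_exists (fun k => exists S N : {set {set D}},
    [/\ S \subset double_points P, N \subset double_points P, [disjoint S & N],
        #|S| + #|N| = k & reducible (splice P S N)]).
  exists #|S|, S, set0; rewrite sub0set cards0 addn0 -setI_eq0 setI0 eqxx.
  by rewrite splice_seifert.
by exists t, r, y, i.
Qed.

Lemma is_t_le_r t r : is_t P t -> is_r P r -> t <= r.
Proof.
move=> [_ le_t] [redr _]; apply: le_t.
have [d0 _] := marked_start mkP; have orO := single_orientation d0 wfP scP.
have pg := seifert_pairing wfP scP orO.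
rewrite -(resolve0 P (seifert_partner P)) in redr.
have [||T [g [pg' subT cardT redT]]] := reducible_after_resolve wfP pg _ _ redr.
- exact: sub0set.
- by rewrite resolve0.
have [S [N [subS subN dis card E]]] := resolve_splice wfP scP pg' subT.
by exists S, N; rewrite E card cardT cards0.
Qed.

Lemma is_t_le_y t y : is_t P t -> is_y P y -> t <= y.
Proof.
move=> [_ le_t] [[N [subN cardN redN]] _]; apply: le_t; exists set0, N.
by rewrite sub0set cards0 -setI_eq0 set0I eqxx.
Qed.

Lemma is_t_le_i t i : is_t P t -> is_i P i -> t <= i.
Proof.
move=> [_ le_t] [[S [subS cardS redS]] _]; apply: le_t; exists S, set0.
by rewrite sub0set cards0 addn0 -setI_eq0 setI0 eqxx.
Qed.

Lemma splice_set0 : splice P set0 set0 = P.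
Proof. by rewrite splice_seifert resolve0. Qed.

Lemma is_i_even i : is_i P i -> ~~ odd i.
Proof.
have [d0 _] := marked_start mkP; have orO := single_orientation d0 wfP scP.
move=> [[S [subS <- [[_ scQ _ _] _]]] _]; rewrite splice_seifert in scQ.
apply: (seifert_single_even wfP (seifert_pairing wfP scP orO)
  scP subS orO _ scQ).
move=> d dS; apply: (orientation_seifert wfP scP orO).
exact: order_double subS _ dS.
Qed.

Lemma is_i_gt0 i : is_i P i -> 0 < i.
Proof.
case=> [[S [_ cardS redS]] _]; rewrite lt0n; apply/eqP => i0; move: redS.
by rewrite (cards0_eq (etrans cardS i0)) splice_set0;
  apply: reduced_not_reducible.
Qed.

Lemma is_y_gt0 y : is_y P y -> 0 < y.
Proof.
case=> [[N [_ cardN redN]] _]; rewrite lt0n; apply/eqP => y0; move: redN.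
by rewrite (cards0_eq (etrans cardN y0)) splice_set0;
  apply: reduced_not_reducible.
Qed.

Lemma is_i_2 i (S : {set {set D}}) : is_i P i ->
  S \subset double_points P -> #|S| = 2 -> reducible (splice P S set0) -> i = 2.
Proof.
move=> Hi subS cardS redS; have := is_i_even Hi; have := is_i_gt0 Hi.
have : i <= 2 by case: Hi => _; apply; exists S.
by case: i {Hi} => [|[|[|]]].
Qed.

Lemma is_y_le y (N : {set {set D}}) k : is_y P y ->
  N \subset double_points P -> #|N| = k -> reducible (splice P set0 N) ->
    y <= k.
Proof. by move=> [_ le_y] subN cardN redN; apply: le_y; exists N. Qed.

End Reductivities.

(** * Order of passages and connectedness *)

Section Outgoing.

Variables (D : finType) (P : diagram D) (O : pred D).
Hypotheses (wfP : well_formed P) (orO : orientation P O).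

(** Crossing the vertex exchanges outgoing and incoming darts. *)
Lemma card_outgoing v : v \in double_points P -> #|[set y in v | O y]| <= 2.
Proof.
move=> vP; set A := [set _ in _ | _].
have := card_double vP; have [d0 Ev _] := doubleP vP.
have sub : A :|: through P @: A \subset v.
  apply/subsetP=> y; rewrite inE => /orP[|/imsetP[z]]; rewrite inE =>
    /andP[// yv _].
  move=> ->; move: yv; rewrite Ev => /(mem_vertex_eq wfP) <-.
  by rewrite -(vertex_through wfP) vertex_id.
have dis : A :&: through P @: A = set0.
  apply/setP=> y; rewrite !inE; apply/negP => /andP[/andP[_ Oy] /imsetP[z]].
  by rewrite inE => /andP[_ Oz] E; move: Oy;
    rewrite E (orientation_through wfP orO) Oz.
have := subset_leq_card sub; rewrite cardsU dis cards0 subn0.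
rewrite card_imset; last exact: can_inj (throughK wfP).
by move=> + E; rewrite E addnn; move: #|A| => n; clear; lia.
Qed.

Lemma outgoing_other p q u : order (rot P) p = 4 ->
  q \in vertex P p -> u \in vertex P p -> O p -> O q -> O u ->
  q != p -> u != p -> u = q.
Proof.
move=> o4 qv uv Op Oq Ou qp up; apply/eqP; apply: contraT => uq.
have vP : vertex P p \in double_points P by rewrite vertex_double // o4.
have := card_outgoing vP; rewrite leqNgt => /negP[].
have sub : {subset [:: p; q; u] <= [set y in vertex P p | O y]}.
  by move=> y; rewrite !inE => /or3P[]/eqP->;
    rewrite -?mem_vertex ?vertex_id ?qv ?uv.
apply: (leq_trans _ (subset_leq_card (introT subsetP sub))).
have us : uniq [:: p; q; u].
  by rewrite /= !inE negb_or (eq_sym p) qp (eq_sym p) up (eq_sym q) uq.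
by rewrite (card_uniqP us).
Qed.

End Outgoing.

Section Cutting.

Variables (D : finType) (P : diagram D) (g : D -> D) (x : D).
Hypotheses (wfP : well_formed P) (scP : single_curve P)
  (pg : planar_pairing P g).

Let f := trav P.
Let O := fconnect f x.
Let orO : orientation P O. Proof. exact: single_orientation. Qed.

Lemma subseq_orbit_findex s : subseq s (orbit f x) ->
  sorted ltn [seq findex f x y | y <- s].
Proof.
move=> sub; apply: subseq_sorted (map_subseq _ sub) _; first exact: ltn_trans.
suff -> : [seq findex f x y | y <- orbit f x] = iota 0 (order f x)
  by apply: iota_ltn_sorted.
apply: (@eq_from_nth _ 0); rewrite size_map size_orbit ?size_iota // => i lt_i.
rewrite (nth_map x) ?size_orbit // nth_iota // /orbit nth_traject //.
by rewrite findex_iter.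
Qed.

Lemma resolve_trav_out (T : {set {set D}}) z : T \subset double_points P ->
  vertex P (f z) \notin T -> trav (resolve P T g) z = f z.
Proof.
by move=> subT; rewrite /f /trav vertex_through // => zT;
  rewrite resolve_through_out.
Qed.

(** The Seifert splice turns an incoming strand to the other outgoing dart. *)
Lemma seifert_trav_in (T : {set {set D}}) p p' z : T \subset double_points P ->
  vertex P p \in T -> p' \in vertex P p -> p' != p -> O p -> O p' ->
  (forall d, vertex P d \in T -> O (g d) = ~~ O d) ->
  f z = p -> trav (resolve P T g) z = p'.
Proof.
move=> subT pT p'p neq Op Op' anti fz; have o4 := order_double wfP subT pT.
have vz : vertex P (opp P z) = vertex P p by rewrite -fz /f /trav
  vertex_through.
have zT : vertex P (opp P z) \in T by rewrite vz.
have -> : trav (resolve P T g) z = g (opp P z).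
  by rewrite /trav /through (resolve_order_in wfP subT pg zT) /= zT.
have o4z := order_double wfP subT zT.
have Ep : p = rot P (rot P (opp P z)) by rewrite -fz /f /trav /through o4z eqxx.
apply: (outgoing_other wfP orO o4) => //.
- by rewrite -vz -(pairing_vertex wfP pg o4z) vertex_id.
- by rewrite anti // (proj2 orO) negbK -[O z](proj1 orO) -/f fz.
have [r4 u _] := rot4 wfP o4z; rewrite Ep.
case: (pg o4z) => _ [->|E].
  by rewrite (inj_eq (rot_inj wfP)); move: u; rewrite /= !inE !negb_or =>
    /and3P[/andP[]].
apply/eqP => E2; move: E; rewrite E2 => E3.
by move: u; rewrite /= !inE E3 eqxx !orbT.
Qed.

(** After the splice, the arc of the traversal from p up to p' closes up to a
    curve of its own: it contains q and not q'. *)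
Lemma alternating_interlaced p q p' q' :
  order (rot P) p = 4 -> vertex P p' = vertex P p ->
  subseq [:: p; q; p'; q'] (orbit f x) ->
  (forall d, d \in vertex P p -> O (g d) = ~~ O d) ->
  ~~ fconnect (trav (resolve P [set vertex P p] g)) q q'.
Proof.
move=> o4 vp' sub anti; set Q := resolve _ _ _.
have := subseq_orbit_findex sub; rewrite /= => /and4P[lt_pq lt_qp' lt_p'q' _].
have subT : [set vertex P p] \subset double_points P by rewrite sub1set
  vertex_double // o4.
have Oall y : y \in [:: p; q; p'; q'] -> O y by move/(mem_subseq sub);
  rewrite -fconnect_orbit.
have Op : O p by apply: Oall; rewrite !inE eqxx.
have Oq : O q by apply: Oall; rewrite !inE eqxx !orbT.
have Op' : O p' by apply: Oall; rewrite !inE eqxx !orbT.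
have p'v : p' \in vertex P p by rewrite -vp' vertex_id.
have neq : p' != p by apply: contraTneq (ltn_trans lt_pq lt_qp') => ->;
  rewrite ltnn.
pose A z := O z && (findex f x p <= findex f x z < findex f x p').
have clo z : A z -> A (trav Q z).
  case/andP=> Oz /andP[le_pz lt_zp'].
  have fz_iter : f z = iter (findex f x z).+1 f x by rewrite iterS iter_findex.
  have Ofz : O (f z) by rewrite /O -same_fconnect1_r //; apply: trav_inj.
  have ord : (findex f x z).+1 < order f x by apply: leq_ltn_trans (findex_max
    Op').
  have fi : findex f x (f z) = (findex f x z).+1 by rewrite fz_iter findex_iter.
  have [E|ne] := eqVneq (f z) p'.
    have -> : trav Q z = p.
      apply: (seifert_trav_in subT _ _ _ Op' Op _ E);
        rewrite ?vp' ?set11 ?vertex_id 1?eq_sym //.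
      by move=> d; rewrite inE => /eqP dp; apply: anti; rewrite -dp vertex_id.
    by rewrite /A Op leqnn (ltn_trans lt_pq).
  have lt_fz : findex f x (f z) < findex f x p'.
    rewrite ltn_neqAle fi lt_zp' andbT -fi; apply: contra ne => /eqP E.
    by rewrite -(iter_findex Ofz) E iter_findex.
  have -> : trav Q z = f z.
    apply: resolve_trav_out => //; rewrite inE; apply/eqP => E.
    case/eqP: ne; apply: (outgoing_other wfP orO o4) => //.
      by rewrite -E vertex_id.
    by apply: contraTneq le_pz => <-; rewrite fi ltnn.
  by rewrite /A Ofz lt_fz fi (leq_trans le_pz).
have Aq : A q by rewrite /A Oq (ltnW lt_pq).
apply/negP => /iter_findex E; have : A q'.
  by rewrite -E; elim: (findex _ _ _) => //= n; apply: clo.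
by case/andP=> _ /andP[_]; rewrite ltnNge (ltnW lt_p'q').
Qed.

(** The arc from p' through the base point x to p avoids the vertex of q, so the
    splice there does not affect it. *)
Lemma nested_connected p q q' p' :
  order (rot P) q = 4 -> vertex P q' = vertex P q ->
  subseq [:: p; q; q'; p'] (orbit f x) ->
  fconnect (trav (resolve P [set vertex P q] g)) p' p.
Proof.
move=> o4 vq' sub; set Q := resolve _ _ _.
have := subseq_orbit_findex sub; rewrite /= => /and4P[lt_pq lt_qq' lt_q'p' _].
have subT : [set vertex P q] \subset double_points P by rewrite sub1set
  vertex_double // o4.
have Oall y : y \in [:: p; q; q'; p'] -> O y by move/(mem_subseq sub);
  rewrite -fconnect_orbit.
have Op : O p by apply: Oall; rewrite !inE eqxx.
have Oq : O q by apply: Oall; rewrite !inE eqxx !orbT.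
have Oq' : O q' by apply: Oall; rewrite !inE eqxx !orbT.
have Op' : O p' by apply: Oall; rewrite !inE eqxx !orbT.
have q'v : q' \in vertex P q by rewrite -vq' vertex_id.
have neq : q' != q by apply: contraTneq lt_qq' => ->; rewrite ltnn.
set i := findex f x p in lt_pq; set j := findex f x q in lt_pq lt_qq'.
set k := findex f x q' in lt_qq' lt_q'p'; set l := findex f x p' in lt_q'p'.
have ltl : l < order f x := findex_max Op'.
have out m : m < order f x -> m != j -> m != k -> vertex P (iter m f x)
  != vertex P q.
  move=> lt_m mj mk; apply: contraNneq mk => E.
  rewrite -(findex_iter lt_m) /k; apply/eqP; congr findex.
  apply: (outgoing_other wfP orO o4) => //.
  - by rewrite -E vertex_id.
  - exact: fconnect_iter.
  by apply: contraNneq mj => Em; rewrite -(findex_iter lt_m) Em.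
have stepQ m : vertex P (iter m.+1 f x) != vertex P q -> fconnect (trav Q)
  (iter m f x) (iter m.+1 f x).
  by move=> nv; rewrite iterS -(resolve_trav_out subT) ?inE // fconnect1.
have start0 m : m <= i -> fconnect (trav Q) x (iter m f x).
  elim: m => [|m IH] lt_mi; first exact: connect0.
  apply: connect_trans (IH (ltnW lt_mi)) (stepQ _ (out _ _ _ _)).
  - by clear -lt_mi lt_pq lt_qq' lt_q'p' ltl; lia.
  - by clear -lt_mi lt_pq lt_qq' lt_q'p' ltl; lia.
  by clear -lt_mi lt_pq lt_qq' lt_q'p' ltl; lia.
have tail m : l + m < order f x -> fconnect (trav Q) p' (iter (l + m) f x).
  elim: m => [|m IH] lt_m; first by rewrite addn0 iter_findex // connect0.
  rewrite addnS in lt_m *; apply: connect_trans (IH (ltnW lt_m))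
    (stepQ _ (out _ _ _ _)) => //.
    by clear -lt_m lt_pq lt_qq' lt_q'p' ltl; lia.
  by clear -lt_m lt_pq lt_qq' lt_q'p' ltl; lia.
have ord0 : iter (order f x) f x = x by apply: iter_order; apply: trav_inj.
have vx : vertex P x != vertex P q.
  have := out 0; rewrite /=; apply; first by rewrite -orderSpred.
    by clear -lt_pq lt_qq' lt_q'p' ltl; lia.
  by clear -lt_pq lt_qq' lt_q'p' ltl; lia.
have top : fconnect (trav Q) p' x.
  have lt_o : (order f x).-1 < order f x by rewrite orderSpred.
  have := tail ((order f x).-1 - l); rewrite subnKC; last first.
    by rewrite -ltnS orderSpred.
  move=> /(_ lt_o) h; apply: connect_trans h _.
  by have := stepQ (order f x).-1; rewrite orderSpred ord0; apply.
by rewrite -(iter_findex Op); apply: connect_trans top (start0 _ _).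
Qed.

End Cutting.

(** * Corners of polygons *)

Lemma uniq_map_in_inj (T1 T2 : eqType) (h : T1 -> T2) (s : seq T1) :
  uniq (map h s) -> {in s &, injective h}.
Proof.
elim: s => [|x s IH] //= /andP[xs us] y z; rewrite !inE.
case/orP=> [/eqP->|ys] /orP[/eqP->|zs] //; last exact: IH.
  by move=> E; rewrite E map_f in xs.
by move=> E; rewrite -E map_f in xs.
Qed.

Section PolygonBasics.

Variables (D : finType) (P : diagram D).
Hypotheses (wfP : well_formed P).

Lemma vertex_face z : vertex P (face P z) = vertex P (opp P z).
Proof. exact: vertex_rot. Qed.

Section Corner.

Variable O : pred D.
Hypotheses (scP : single_curve P) (orO : orientation P O).

Lemma rot3_corner z : order (rot P) (face P z) = 4 -> iter 3 (rot P)
  (face P z) = opp P z.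
Proof.
by rewrite /face order_rot // => o4; have [] := rot4 wfP o4.
Qed.

Lemma orient_rot_corner z : order (rot P) (face P z) = 4 ->
  O (rot P (face P z)) = O z.
Proof.
rewrite /face order_rot // => o4; rewrite (orientation_rot2 wfP orO o4).
by rewrite (proj2 orO) negbK.
Qed.

(** At a coherent corner one side comes in and the other goes out: joining them
    is the Seifert splice. *)
Lemma seifert_corner z : order (rot P) (face P z) = 4 ->
  O (face P z) = O z -> seifert_partner P (face P z) = opp P z.
Proof.
move=> o4 E; rewrite /seifert_partner (codirectedE scP orO).
by rewrite orient_rot_corner // E eqxx rot3_corner.
Qed.

Lemma nonseifert_corner z : order (rot P) (face P z) = 4 ->
  O (face P z) = ~~ O z -> nonseifert_partner P (face P z) = opp P z.
Proof.
move=> o4 E; rewrite /nonseifert_partner (codirectedE scP orO).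
by rewrite orient_rot_corner // E rot3_corner //; case: (O z).
Qed.

End Corner.

(** The sides of the polygon become a loop based at the vertex of d'; going
    round it on the outside joins the two corners of that vertex adjacent to the
    loop. *)
Lemma polygon_nugatory n d d' (T : {set {set D}}) (g : D -> D) :
  planar_pairing P g -> T \subset double_points P -> is_gon P n d ->
  d' \in orbit (face P) d -> order (rot P) d' = 4 -> vertex P d' \notin T ->
  (forall e, e \in orbit (face P) d -> vertex P e != vertex P d' ->
    vertex P e \in T) ->
  (forall z, z \in orbit (face P) d -> vertex P (face P z) \in T ->
    g (face P z) = opp P z) ->
  nugatory (resolve P T g) (vertex P d').
Proof.
move=> pg subT [_ un] d'd o4 d'T others keep; set Q := resolve P T g.
have injF := face_inj wfP.
have dd' : fconnect (face P) d d' by rewrite fconnect_orbit.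
have inorb k : iter k (face P) d' \in orbit (face P) d.
  by rewrite -fconnect_orbit; apply: connect_trans dd' (fconnect_iter _ _ _).
have inT k : k.+1 < order (face P) d' -> vertex P (iter k.+1 (face P) d') \in T.
  move=> lt_k; apply: others => //; apply/eqP => /(uniq_map_in_inj un).
  move=> /(_ (inorb _) d'd) E; have := findex_iter lt_k.
  by rewrite E findex0.
have chain k : k < order (face P) d' ->
  fconnect (face Q) (opp P (iter k (face P) d')) (rot P d').
  elim: k => [|k IH] lt_k.
    rewrite /= (_ : rot P d' = face Q (opp P d')) ?fconnect1 //.
    by rewrite /face /= oppK // (negPf d'T).
  apply: connect_trans (IH (ltnW lt_k)).
  rewrite (_ : opp P (iter k _ _) = face Q (opp P (iter k.+1 (face P) d')))
    ?fconnect1 //.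
  rewrite {1}/face /= oppK // ; have := inT _ lt_k; rewrite iterS => kT.
  by rewrite kT keep.
have lt_o : (order (face P) d').-1 < order (face P) d' by rewrite orderSpred.
have := chain _ lt_o; set z := iter _ _ d'; set b := opp P z => con.
have Eb : rot P b = d'.
  by rewrite -[rot P b]/(face P z) /z -iterS orderSpred iter_order.
have vb : vertex P b = vertex P d' by rewrite -Eb vertex_rot.
split; first by rewrite resolve_double // inE d'T vertex_double // o4.
exists b; first by rewrite -vb vertex_id.
by rewrite /= vb (negPf d'T) Eb (negPf d'T).
Qed.

Section CornerCount.

Variable O : pred D.
Hypotheses (orO : orientation P O).

(** Each of the n sides occurs once in ys, in its own direction.  Of the two
    sides at a corner, the one after it starts there if it follows the polygon,
    and the one before it starts there if it does not. *)
Lemma corner_count n d (ys : seq D) z : is_gon P n d -> 1 < n -> uniq ys ->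
  size ys = n ->
  (forall y, y \in ys -> O y /\ on_boundary P d y) -> z \in orbit (face P) d ->
  count_mem (vertex P (face P z)) [seq vertex P y | y <- ys] = O (face P z)
    + ~~ O z.
Proof.
move=> [on un] n1 uys sz ysP zd; set s := orbit (face P) d in un zd.
have injv := uniq_map_in_inj un.
have szs : size s = n by rewrite size_orbit.
pose e z := if O z then z else opp P z.
have sub : {subset ys <= map e s}.
  move=> y /ysP[Oy]; rewrite /on_boundary !fconnect_orbit -/s => /orP[ys1|ys1].
    by apply/mapP; exists y; rewrite // /e Oy.
  by apply/mapP; exists (opp P y); rewrite // /e (proj2 orO) Oy oppK.
have szm : size (map e s) <= size ys by rewrite size_map szs sz.
have pe : perm_eq ys (map e s).
  have [_ E] := uniq_min_size uys sub szm.
  by apply: uniq_perm => //; apply: leq_size_uniq sub szm.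
rewrite (permP (perm_map (vertex P) pe)) -map_comp count_map.
have fzs : face P z \in s by apply: mem_orbit.
have us : uniq s by apply: orbit_uniq.
have neq : face P z != z.
  apply: contraTneq n1 => E; rewrite -leqNgt -on.
  have dz : fconnect (face P) d z by rewrite fconnect_orbit.
  have := orbit_uniq (face P) z.
  have -> : order (face P) d = order (face P) z.
    by apply: eq_card => u; exact: (same_connect (fconnect_sym (face_inj wfP)))
      dz u.
  case: (ltnP 1 (order (face P) z)) => // lt1; have := findex_iter lt1.
  by rewrite /= E findex0.
have cnt u (b : bool) : u \in s -> count (fun y => (y == u) && b) s = b.
  move=> us'; case: b => /=; last by rewrite (eq_count (a2 := pred0))
    ?count_pred0 // => y /=; rewrite andbF.
  by rewrite (eq_count (a2 := pred1 u)) ?count_uniq_mem ?us' // => y /=;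
    rewrite andbT.
rewrite -(cnt _ (O (face P z)) fzs) -(cnt _ (~~ O z) zd) -count_predUI.
rewrite [X in _ = _ + X](eq_count (a2 := pred0)) ?count_pred0 ?addn0;
  last first.
  move=> y /=; case: eqP => //= ->; by rewrite (negPf neq) andbF.
apply: eq_in_count => y ysy /=; rewrite /e.
have fys : face P y \in s by apply: mem_orbit.
case Oy: (O y).
  rewrite (inj_in_eq injv) //; case: (eqVneq y (face P z)) => [<-|_] /=;
    first by rewrite Oy.
  by case: (eqVneq y z) => //= <-; rewrite Oy.
rewrite -vertex_face (inj_in_eq injv) // (inj_eq (face_inj wfP)).
case: (eqVneq y z) => [Ez|_] /=; first by rewrite -Ez Oy orbT.
by case: (eqVneq y (face P z)) => //= <-; rewrite Oy.
Qed.

End CornerCount.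
End PolygonBasics.

Section Passages.

Variables (D : finType) (P : diagram D) (d x : D).
Hypotheses (wfP : well_formed P) (scP : single_curve P).
Hypothesis all4 : forall e, order (rot P) e = 4.

Let O := fconnect (trav P) x.
Let orO : orientation P O. Proof. exact: single_orientation. Qed.

Lemma passages_subseq : subseq (passages P d x) (orbit (trav P) x).
Proof. exact: filter_subseq. Qed.

Lemma passages_uniq : uniq (passages P d x).
Proof. exact: filter_uniq (orbit_uniq _ _). Qed.

Lemma passages_outgoing y : y \in passages P d x -> O y.
Proof. by move/(mem_subseq passages_subseq); rewrite -fconnect_orbit. Qed.

Lemma mem_passages y : O y -> vertex P y \in [seq vertex P e | e <- orbit (face
  P) d] ->
  y \in passages P d x.
Proof. by move=> Oy vy; rewrite mem_filter vy -fconnect_orbit. Qed.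

(** One of the two strands through the vertex leaves it along the
    orientation. *)
Lemma polygon_vertex_met e : e \in orbit (face P) d ->
  vertex P e \in [seq vertex P y | y <- passages P d x].
Proof.
move=> ed; pose y := if O e then e else through P e.
have vy : vertex P y = vertex P e by rewrite /y; case: ifP => // _;
  rewrite vertex_through.
rewrite -vy; apply/map_f/mem_passages; last by rewrite vy map_f.
by rewrite /y; case: ifP => // /negbT; rewrite -(orientation_through wfP orO).
Qed.

Lemma met_polygon_vertex v : v \in [seq vertex P y | y <- passages P d x] ->
  exists2 e, e \in orbit (face P) d & v = vertex P e.
Proof.
by case/mapP=> y; rewrite mem_filter => /andP[/mapP[e ed ->] _] ->; exists e.
Qed.

Lemma count_passages v : count_mem v [seq vertex P y | y <- passages P d x] <=
  2.
Proof.
case: (boolP (v \in [seq vertex P y | y <- passages P d x])) =>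
  [|/count_memPn-> //].
case/met_polygon_vertex => e _ ->.
have vP : vertex P e \in double_points P by rewrite vertex_double // all4.
apply: leq_trans (card_outgoing wfP orO vP); rewrite count_map -size_filter.
have us := filter_uniq (preim (vertex P) (pred1 (vertex P e))) passages_uniq.
rewrite -(card_uniqP us); apply/subset_leq_card/subsetP => y.
rewrite mem_filter => /andP[/eqP Ey /passages_outgoing Oy].
by rewrite inE -Ey vertex_id.
Qed.

End Passages.

(** * Coherent 2-gons and 3-gons of types C and A *)

Section Polygons.

Variables (D : finType) (P : diagram D).
Hypothesis redP : reduced P.

Let mkP : marked_knot_projection P. Proof. by case: redP => -[]. Qed.
Let wfP : well_formed P. Proof. by case: mkP. Qed.
Let scP : single_curve P. Proof. by case: mkP. Qed.
Let all4 e : order (rot P) e = 4. Proof. by case: redP => -[]. Qed.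

Lemma vertex_is_double e : vertex P e \in double_points P.
Proof. by rewrite vertex_double // all4. Qed.

Lemma polygon_reducible n d d' (T : {set {set D}}) g :
  planar_pairing P g -> T \subset double_points P -> is_gon P n d ->
  d' \in orbit (face P) d -> vertex P d' \notin T ->
  (forall e, e \in orbit (face P) d -> vertex P e != vertex P d' ->
    vertex P e \in T) ->
  (forall z, z \in orbit (face P) d -> vertex P (face P z) \in T ->
    g (face P z) = opp P z) ->
  single_curve (resolve P T g) -> reducible (resolve P T g).
Proof.
move=> pg subT gon d'd d'T others keep scQ; split.
  apply: resolve_marked => //; rewrite properE subT; apply/subsetPn.
  by exists (vertex P d'); rewrite ?vertex_is_double.
by exists (vertex P d'); apply: polygon_nugatory gon _ _ _ _ _.
Qed.

Section Traversal.

Variables (n : nat) (d x : D) (w : seq {set D}).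
Hypotheses (gon : is_gon P n d) (n_gt1 : 1 < n).
Hypothesis Ew : [seq vertex P y | y <- passages P d x] = w.
Hypothesis size_w : size w = n.*2.
Hypothesis on : forall k, k < order (face P) d ->
  on_boundary P d (nth x (passages P d x) k.*2).

Let O := fconnect (trav P) x.
Let orO : orientation P O. Proof. exact: single_orientation. Qed.

(** The entries of w of even rank are the starting points of the sides. *)
Lemma traversed_corner_count z : z \in orbit (face P) d ->
  count_mem (vertex P (face P z)) [seq nth set0 w k.*2 | k <- iota 0 n] =
  O (face P z) + ~~ O z.
Proof.
move=> zd; have sps : size (passages P d x) = n.*2 by rewrite -size_w -Ew
  size_map.
have lt2 k : k \in iota 0 n -> k.*2 < size (passages P d x).
  by rewrite mem_iota sps ltn_double.
set ys := [seq nth x (passages P d x) k.*2 | k <- iota 0 n].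
have -> : [seq nth set0 w k.*2 | k <- iota 0 n] = [seq vertex P y | y <- ys].
  rewrite -map_comp; apply/eq_in_map => k /lt2 kn /=.
  by rewrite -Ew (nth_map x).
have uys : uniq ys.
  rewrite map_inj_in_uniq ?iota_uniq // => k l /lt2 kn /lt2 ln /eqP.
  by rewrite nth_uniq ?passages_uniq // -!muln2 eqn_pmul2r // => /eqP.
apply: (corner_count wfP orO gon n_gt1 uys) => //;
  first by rewrite size_map size_iota.
move=> y /mapP[k kn ->]; split.
  by apply: (passages_outgoing (d := d)); rewrite mem_nth // lt2.
by apply: on; case: gon => -> _; rewrite mem_iota in kn.
Qed.

Lemma traversed_vertex e : e \in orbit (face P) d -> vertex P e \in w.
Proof. by rewrite -Ew; apply: polygon_vertex_met. Qed.

Lemma vertex_traversed v : v \in w -> exists2 e, e \in orbit (face P) d &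
  v = vertex P e.
Proof. by rewrite -Ew; apply: met_polygon_vertex. Qed.

Lemma traversed_double v : v \in w -> v \in double_points P.
Proof. by case/vertex_traversed=> e _ ->; apply: vertex_is_double. Qed.

Lemma traversed_count v : count_mem v w <= 2.
Proof. by rewrite -Ew; apply: count_passages. Qed.

(** If each vertex is the starting point of exactly one side, no corner has both
    or none of its sides leaving. *)
Lemma traversed_coherent : uniq [seq nth set0 w k.*2 | k <- iota 0 n] ->
  {subset w <= [seq nth set0 w k.*2 | k <- iota 0 n]} ->
  forall z, z \in orbit (face P) d -> O (face P z) = O z.
Proof.
move=> us sub z zd; have := traversed_corner_count zd.
rewrite (count_uniq_mem _ us) sub; last by apply/traversed_vertex/mem_orbit.
by case: (O _) (O z) => [] [].
Qed.

End Traversal.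

Lemma coherent_2gon_reducible d : coherent_2gon P d ->
  exists S : {set {set D}}, [/\ S \subset double_points P, #|S| = 2 &
    reducible (splice P S set0)].
Proof.
case=> gon [v1 [v2 [x [Ew on]]]]; have [o2 un] := gon.
have orO := single_orientation x wfP scP.
have c2 := traversed_count Ew.
have n12 : v1 != v2 by apply: contraTneq (c2 v1) => <-; rewrite /= eqxx.
have coh : forall z, z \in orbit (face P) d -> fconnect (trav P) x (face P z)
  = fconnect (trav P) x z.
  have tc := traversed_coherent gon isT Ew erefl on; apply: tc => /=;
    first by rewrite inE n12.
  by move=> v; rewrite !inE => /or4P[] ->; rewrite ?orbT.
set O := fconnect _ _ in orO coh; set d1 := face P d.
have Eo : orbit (face P) d = [:: d; d1] by rewrite /orbit o2.
have fd1 : face P d1 = d.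
  by have := iter_order (face_inj wfP) d; rewrite o2.
have pg := seifert_pairing wfP scP orO.
have anti c e : c \in double_points P -> e \in c -> O (seifert_partner P e)
  = ~~ O e.
  by move=> _ _; apply: (orientation_seifert wfP scP orO).
have cP := vertex_is_double d1; set c := vertex P d1 in cP.
have dc : vertex P d != c by move: un; rewrite Eo /= inE andbT.
have keep z : z \in orbit (face P) d -> seifert_partner P (face P z) = opp P z.
  by move=> zd; apply: (seifert_corner wfP scP orO); rewrite ?coh.
have dd : d \in orbit (face P) d by apply: in_orbit.
have dd1 : d1 \in orbit (face P) d by apply: mem_orbit.
have sub1 : [set c] \subset double_points P by rewrite sub1set.
have [v [vP vc inter]] := interlaced_exists mkP orO pg (reduced_not_reducible
  redP) cP (anti _ ^~ cP).
case: inter => p [q [pv qv Op Oq npq]].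
have vd : v != vertex P d.
  apply: contraNneq npq => Ev; set Q := resolve _ _ _.
  have wfQ : well_formed Q by apply: resolve_wf.
  have orQ : orientation Q O.
    by apply: resolve_orientation => // e; rewrite inE => _;
      apply: (orientation_seifert wfP scP orO).
  have dT : vertex P d \notin [set c] by rewrite inE.
  have rd e : e \in vertex P d -> rot Q e = rot P e.
    by move/(mem_vertex_eq wfP) => E /=; rewrite E (negPf dT).
  (* After the splice at c the two sides of the polygon form a loop based at the
     vertex of d, so the two strands through that vertex are on one curve and v,
     whose strands have been separated, is another double point. *)
  have loop : fconnect (trav Q) (rot P d) (iter 3 (rot Q) (rot P d)).
    have r3 : iter 3 (rot Q) (rot P d) = d.
      have [r4 _ _] := rot4 wfP (all4 d).
      have rv k : iter k (rot P) d \in vertex P d by rewrite mem_vertex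
        fconnect_iter.
      rewrite -[LHS]/(rot Q (rot Q (rot Q (rot P d)))).
      by rewrite (rd _ (rv 1)) (rd _ (rv 2)) (rd _ (rv 3)).
    rewrite r3 (fconnect_sym (trav_inj wfQ)).
    have tr0 : trav Q d = d1.
      have vo : vertex P (opp P d) \in [set c] by rewrite -vertex_face // inE.
      rewrite /trav /through (resolve_order_in wfP sub1 pg vo) /= vo.
      by rewrite -(keep d dd); have [-> _] := pg _ (all4 d1).
    have tr1 : trav Q d1 = rot P d.
      have vo : vertex P (opp P d1) \notin [set c] by rewrite -vertex_face //
        fd1.
      by rewrite /trav resolve_through_out // /through all4 eqxx -/(face P d1)
        fd1.
    by rewrite -tr1 -tr0 -!(same_fconnect1_r (trav_inj wfQ)) connect0.
  apply: contraTT loop => npq'.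
  have o4Q : order (rot Q) (rot P d) = 4.
    by rewrite resolve_order_out ?all4 // vertex_rot.
  apply: (interlaced_corners wfQ orQ o4Q _ _ _ _ npq'); last by rewrite Op Oq.
  - rewrite rd ?mem_vertex ?fconnect1 // (orientation_rot2 wfP orO) ?all4 //.
    congr (~~ _); rewrite -(coh d dd) -(orient_rot_corner wfP orO) ?all4 //.
    by congr (O (rot P _)); exact: fd1.
  - by rewrite (resolve_vertex_out _ wfP) ?vertex_rot // -Ev.
  by rewrite (resolve_vertex_out _ wfP) ?vertex_rot // -Ev.
have scQ : single_curve (resolve P [set v; c] (seifert_partner P)).
  apply: (interlaced_single wfP pg orO scP cP vP vc _ _ pv qv _ npq).
  - by move=> e; apply: anti.
  - by move=> e; apply: anti.
  by rewrite Op Oq.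
exists [set v; c]; split; first by rewrite subUset !sub1set vP.
  by rewrite cards2 vc.
rewrite splice_seifert; apply: (polygon_reducible (d' := d) pg _ gon dd) => //.
- by rewrite subUset !sub1set vP.
- by rewrite !inE negb_or eq_sym vd.
- by move=> e; rewrite Eo !inE => /orP[]/eqP->; rewrite ?eqxx // orbT.
by move=> z zd _; apply: keep.
Qed.

Lemma type_C_reducible d : type_C_3gon P d ->
  exists S : {set {set D}}, [/\ S \subset double_points P, #|S| = 2 &
    reducible (splice P S set0)].
Proof.
case=> gon [v1 [v2 [v3 [x [Ew on]]]]].
have orO := single_orientation x wfP scP.
have c2 := traversed_count Ew.
have n12 : v1 != v2 by apply: contraTneq (c2 v1) => <-; rewrite /= eqxx;
  case: eqP.
have n13 : v1 != v3 by apply: contraTneq (c2 v1) => <-; rewrite /= eqxx;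
  case: eqP.
have n23 : v2 != v3 by apply: contraTneq (c2 v2) => <-; rewrite /= eqxx;
  case: eqP.
have coh : forall z, z \in orbit (face P) d -> fconnect (trav P) x (face P z)
  = fconnect (trav P) x z.
  have tc := traversed_coherent gon isT Ew erefl on; apply: tc => /=.
    by rewrite !inE negb_or n12 n13 eq_sym n23.
  by move=> v; rewrite !inE => /or4P[|||/or3P[]] ->; rewrite ?orbT.
set O := fconnect _ _ in orO coh.
have v1P : v1 \in double_points P by apply: (traversed_double Ew);
  rewrite inE eqxx.
have v2P : v2 \in double_points P by apply: (traversed_double Ew);
  rewrite !inE eqxx orbT.
have [d' d'd Ed'] : exists2 e, e \in orbit (face P) d & v3 = vertex P e.
  by apply: (vertex_traversed Ew); rewrite !inE eqxx !orbT.
have met e := traversed_vertex Ew (e := e).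
have := passages_subseq P d x.
have pg := seifert_pairing wfP scP orO.
have anti e : O (seifert_partner P e) = ~~ O e by apply: (orientation_seifert
  wfP scP orO).
case: (passages P d x) Ew => [|y0 [|y1 [|y2 [|y3 [|y4 [|y5 [|? ?]]]]]]] //= [E0
  E1 E2 E3 E4 E5] sub.
have sub' : subseq [:: y0; y1; y3; y4] (orbit (trav P) x).
  by apply: subseq_trans sub; rewrite /= !eqxx; do !case: eqP => //.
have npq := alternating_interlaced wfP scP pg (all4 y0) (etrans E3 (esym E0))
  sub' (fun e _ => anti e).
have Oall y : y \in [:: y0; y1; y3; y4] -> O y by move/(mem_subseq sub');
  rewrite -fconnect_orbit.
have scQ : single_curve (resolve P [set v2; v1] (seifert_partner P)).
  apply: (interlaced_single (p := y1) (q := y4) wfP pg orO scP v1P v2P) => //.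
  - by rewrite eq_sym.
  - by rewrite -E1 vertex_id.
  - by rewrite -E4 vertex_id.
  - by rewrite !Oall // !inE eqxx ?orbT.
  by rewrite -E0.
exists [set v2; v1]; split; first by rewrite subUset !sub1set v2P.
  by rewrite cards2 eq_sym n12.
rewrite splice_seifert; apply: (polygon_reducible (d' := d') pg _ gon d'd) =>
  //.
- by rewrite subUset !sub1set v2P.
- by rewrite -Ed' !inE negb_or !(eq_sym v3) n13 n23.
- move=> e ed; rewrite -Ed' => /negPf ne; have := met e ed.
  by rewrite !inE ne !orbF /= => /or4P[] ->; rewrite ?orbT.
by move=> z zd _; apply: (seifert_corner wfP scP orO); rewrite ?coh.
Qed.

Lemma type_A_reducible d : type_A_3gon P d ->
  exists N : {set {set D}}, [/\ N \subset double_points P, #|N| = 2 &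
    reducible (splice P set0 N)].
Proof.
case=> gon [v1 [v2 [v3 [x [Ew on]]]]].
have orO := single_orientation x wfP scP.
have c2 := traversed_count Ew.
have n12 : v1 != v2 by apply: contraTneq (c2 v1) => <-; rewrite /= eqxx;
  case: eqP.
have n13 : v1 != v3 by apply: contraTneq (c2 v1) => <-; rewrite /= eqxx;
  case: eqP.
have n23 : v2 != v3 by apply: contraTneq (c2 v2) => <-; rewrite /= eqxx;
  case: eqP.
have cnt := traversed_corner_count gon isT Ew erefl on.
set O := fconnect _ _ in orO cnt.
have v1P : v1 \in double_points P by apply: (traversed_double Ew);
  rewrite inE eqxx.
have v2P : v2 \in double_points P by apply: (traversed_double Ew);
  rewrite !inE eqxx orbT.
have [d' d'd Ed'] : exists2 e, e \in orbit (face P) d & v3 = vertex P e.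
  by apply: (vertex_traversed Ew); rewrite !inE eqxx !orbT.
(* Two sides leave v1 and none leaves v2. *)
have incoh z : z \in orbit (face P) d -> vertex P (face P z) \in [set v2; v1] ->
    O (face P z) = ~~ O z.
  move=> zd; have := cnt z zd; rewrite !inE /= => + /orP[]/eqP E; rewrite E.
    by rewrite (negPf n12) (eq_sym v3) (negPf n23); case: (O (face P z)) (O z)
      => [] [].
  by rewrite eqxx (eq_sym v3) (negPf n13); case: (O (face P z)) (O z) => [] [].
have met e := traversed_vertex Ew (e := e).
have := passages_subseq P d x.
have pg := nonseifert_pairing wfP scP orO.
have same e : O (nonseifert_partner P e) = O e by apply:
  (orientation_nonseifert wfP scP orO).
case: (passages P d x) Ew => [|y0 [|y1 [|y2 [|y3 [|y4 [|y5 [|? ?]]]]]]] //= [E0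
  E1 E2 E3 E4 E5] sub.
have sub' : subseq [:: y0; y1; y3; y4] (orbit (trav P) x).
  by apply: subseq_trans sub; rewrite /= !eqxx; do !case: eqP => //.
have con := nested_connected (nonseifert_partner P) wfP scP (all4 y1)
  (etrans E3 (esym E1)) sub'.
have Oall y : y \in [:: y0; y1; y3; y4] -> O y by move/(mem_subseq sub');
  rewrite -fconnect_orbit.
have O0 : O y0 by apply: Oall; rewrite !inE eqxx.
have O4 : O y4 by apply: Oall; rewrite !inE eqxx !orbT.
have y40 : y4 != y0.
  have := subseq_uniq sub' (orbit_uniq _ _).
  by rewrite (eq_sym y4) /= !inE !negb_or => /andP[/and3P[]].
have sub2 : [set v2] \subset double_points P by rewrite sub1set.
have sc2 : single_curve (resolve P [set v2] (nonseifert_partner P)).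
  by apply: (nonseifert_single wfP pg orO scP v2P) => e _; apply: same.
have wf2 : well_formed (resolve P [set v2] (nonseifert_partner P))
  by apply: resolve_wf.
have or2 := single_orientation y4 wf2 sc2.
have pg2 := resolve_pairing wfP sub2 pg pg.
have v12 : v1 \notin [set v2] by rewrite inE.
have [v1Q EQ] := resolve_add wfP pg sub2 v1P v12.
have scQ : single_curve (resolve P [set v1; v2] (nonseifert_partner P)).
  rewrite -EQ; apply: (nonseifert_single wf2 pg2 or2 sc2 v1Q) => e ev.
  have y0v : vertex P y0 \notin [set v2] by rewrite E0.
  have Ev : v1 = vertex (resolve P [set v2] (nonseifert_partner P)) y0.
    by rewrite resolve_vertex_out ?E0.
  have oQ : order (rot (resolve P [set v2] (nonseifert_partner P))) y0 = 4.
    by rewrite resolve_order_out // all4.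
  apply/eqP; rewrite (pairing_kind wf2 pg2 or2 oQ) -?Ev //.
  have -> : nonseifert_partner P y0 = y4.
    apply: (outgoing_other wfP orO (all4 y0)) => //.
    - by rewrite E0 -E4 vertex_id.
    - by rewrite -(pairing_vertex wfP pg (all4 y0)) vertex_id.
    - by rewrite same.
    exact: (pairing_neq wfP pg (all4 y0)).
  by rewrite connect0 -E1 con.
exists [set v1; v2]; split; first by rewrite subUset !sub1set v1P.
  by rewrite cards2 n12.
rewrite splice_nonseifert; apply: (polygon_reducible (d' := d') pg _ gon d'd)
  => //.
- by rewrite subUset !sub1set v1P.
- by rewrite -Ed' !inE negb_or !(eq_sym v3) n13 n23.
- move=> e ed; rewrite -Ed' => /negPf ne; have := met e ed.
  by rewrite !inE ne !orbF /= => /or4P[] ->; rewrite ?orbT.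
by move=> z zd zT; apply: (nonseifert_corner wfP scP orO) => //; apply: incoh;
  rewrite // setUC.
Qed.

End Polygons.

(** * The torus knot projections of two strands *)

(** Invariants distinguish cycles, so they bound their number from below. *)
Lemma leq_codom_fcard (T U : finType) (f : T -> T) (col : T -> U) :
  injective f -> (forall x, col (f x) = col x) -> #|codom col| <= fcard f T.
Proof.
move=> injf colf; have sub : {subset codom col <= image col (froots f)}.
  move=> _ /codomP[x ->]; apply/imageP; exists (froot f x).
    exact: roots_root (fconnect_sym injf) x.
  have := connect_root (frel f) x => /iter_findex <-.
  by elim: (findex _ _ _) => //= n ->; rewrite colf.
apply: leq_trans (subset_leq_card (introT subsetP sub)) _.
apply: leq_trans (leq_image_card _ _) _.
by apply/subset_leq_card/subsetP => x; rewrite !inE => ->.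
Qed.

Section Torus.

Variable m : nat.
Hypothesis m_gt0 : 0 < m.

Let n := m.*2.+1.
(** The dart (i, (r, t)) leaves the i-th crossing to the right if r and to the
    left if not, above if t and below if not. *)
Definition braid_dart : finType := ('I_n * (bool * bool))%type.

Definition braid_opp (d : braid_dart) : braid_dart :=
  let: (i, (r, t)) := d in (if r then ordS i else ord_pred i, (~~ r, t)).
Definition braid_rot (d : braid_dart) : braid_dart :=
  let: (i, (r, t)) := d in (i, (~~ t, r)).
Definition braid := Diagram braid_opp braid_rot.

Lemma braid_oppK : involutive braid_opp.
Proof. by case=> i [[] t] /=; rewrite ?ordSK ?ord_predK. Qed.

Lemma braid_rotK4 d : iter 4 braid_rot d = d.
Proof. by case: d => i [r t] /=; rewrite !negbK. Qed.

Lemma braid_rot_inj : injective braid_rot.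
Proof. by apply: (can_inj (g := iter 3 braid_rot)) => d; apply: braid_rotK4.
  Qed.

Lemma braid_fconnect_rot d e : fconnect braid_rot d e = (d.1 == e.1).
Proof.
apply/idP/eqP => [/iter_findex <-|E].
  by elim: (findex _ _ _) => //= k ->; case: (iter _ _ _) => i [].
have mem k : iter k braid_rot d = e -> fconnect braid_rot d e.
  by move=> <-; apply: fconnect_iter.
case: d e E mem => i [r t] [_ [r' t']] /= <- mem.
by case: r t r' t' mem => [] [] [] [] mem;
  first [exact: (mem 0) | exact: (mem 1) | exact: (mem 2) | exact: (mem 3)].
Qed.

Lemma braid_order d : order braid_rot d = 4.
Proof.
pose p := [:: d; braid_rot d; iter 2 braid_rot d; iter 3 braid_rot d].
have cyc : fcycle braid_rot p by rewrite /= -[braid_rot (braid_rot (braid_rot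
  (braid_rot d)))]/(iter 4 _ d) braid_rotK4 !eqxx.
apply: (order_cycle cyc) => //; last by rewrite inE eqxx.
rewrite {cyc}/p; by case: d => i [[] []]; rewrite /= !inE /eq_op /= /eq_op /=
  eqxx.
Qed.

Lemma braid_wf : well_formed braid.
Proof.
split; [exact: braid_oppK | | exact: braid_rot_inj | ].
  by case=> i [r t]; apply/eqP => -[_]; case: r.
by move=> d; rewrite braid_order.
Qed.

Definition rightward (d : braid_dart) : bool := d.2.1.

Lemma braid_trav i r t :
  trav braid (i, (r, t)) = (if r then ordS i else ord_pred i, (r, ~~ t)).
Proof. by rewrite /trav /through braid_order /= negbK. Qed.

Lemma braid_orientation : orientation braid rightward.
Proof. by split=> [[i [r t]]|[i [r t]]] //; rewrite braid_trav. Qed.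

Lemma braid_trav_iter k t :
  iter k (trav braid) (ord0, (true, t)) = (inord (k %% n), (true, t (+) odd k)).
Proof.
elim: k => [|k IH]; first by rewrite /= addbF mod0n; congr (_, _);
  apply: val_inj; rewrite /= inordK.
rewrite iterS IH braid_trav /= addbN; congr (_, _); apply: val_inj => /=.
by rewrite !inordK ?ltn_pmod // -addn1 modnDml addn1.
Qed.

Lemma braid_single : single_curve braid.
Proof.
have wf := braid_wf; apply: (orientation_connected wf braid_orientation).
have base e : rightward e -> fconnect (trav braid) (ord0, (true, true)) e.
  case: e => j [r t]; rewrite /rightward /= => ->.
  (* Going once round the braid changes the strand, as n is odd. *)
  pose k := if odd j == ~~ t then val j else j + n.
  have -> : (j, (true, t)) = iter k (trav braid) (ord0, (true, true))
    :> braid_dart.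
    rewrite braid_trav_iter; congr (_, (_, _)).
      apply: val_inj => /=; rewrite inordK ?ltn_pmod // /k; case: ifP => _.
        by rewrite modn_small ?ltn_ord.
      by rewrite modnDr modn_small ?ltn_ord.
    rewrite /k; case: eqP => [->|/eqP]; first by case: (t).
    by rewrite oddD /= odd_double; case: (odd j); case: (t).
  exact: fconnect_iter.
by move=> d e /base dd /base; apply: connect_trans; rewrite fconnect_sym //;
  apply: trav_inj.
Qed.

(** The face on the right of a dart.  A gap between consecutive crossings has
    the number of the crossing on its left. *)
Definition braid_face (d : braid_dart) : 'I_n + bool :=
  let: (i, (r, t)) := d in
  if r == t then inl (if r then i else ord_pred i) else inr t.

Lemma braid_spherical : spherical braid.
Proof.
have wf := braid_wf; apply/eqP; rewrite eqn_leq (single_euler wf braid_single)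
  /=.
have E : fcard braid_opp braid_dart * 2 = n * 4.
  rewrite (fcard_involution braid_oppK (opp_neq wf)).
  by rewrite !card_prod card_bool card_ord.
have V : fcard braid_rot braid_dart * 4 = n * 4.
  have -> : n * 4 = #|braid_dart| by rewrite !card_prod card_bool card_ord.
  apply: (fcard_order_set braid_rot_inj) => //.
  by apply/subsetP=> d _; rewrite inE braid_order.
have F : n + 2 <= fcard (face braid) braid_dart.
  have <- : #|codom braid_face| = n + 2.
    rewrite -[in RHS](card_ord n) -card_bool -card_sum; apply: eq_card =>
      -[i|b].
      by rewrite inE; apply/codomP; exists (i, (true, true)).
    by rewrite inE; apply/codomP; exists (ord0, (~~ b, b)); rewrite /=; case: b.
  apply: leq_codom_fcard; first exact: face_inj.
  by case=> i [[] []]; rewrite /face /= ?ordSK ?ord_predK.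
move: E V F; move: (fcard braid_opp braid_dart) (fcard braid_rot braid_dart)
  (fcard (face braid) braid_dart) => x y z E V F; clear -E V F; lia.
Qed.

Lemma braid_vertex d e : (vertex braid d == vertex braid e) = (d.1 == e.1).
Proof. by rewrite (eq_vertex braid_wf) braid_fconnect_rot. Qed.

Lemma braid_double d : vertex braid d \in double_points braid.
Proof. by rewrite (vertex_double braid_wf) braid_order. Qed.

Lemma card_braid_double : #|double_points braid| = n.
Proof.
have -> : double_points braid = [set vertex braid (i, (true, true)) | i : 'I_n].
  apply/setP=> c; apply/idP/imsetP => [/doubleP[d -> _]|[i _ ->]].
    by exists d.1 => //; apply/eqP; rewrite braid_vertex.
  exact: braid_double.
by rewrite card_imset ?card_ord // => i j /eqP; rewrite braid_vertex => /eqP.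
Qed.

Lemma braid_seifert i r t : seifert_partner braid (i, (r, t)) = (i, (~~ r, t)).
Proof.
rewrite /seifert_partner (codirectedE braid_single braid_orientation) /=.
by case: r t => [] [].
Qed.

(** On the circle of crossings, the gaps on the two sides of crossing k are on
    different sides of the cut {a, b} exactly when k is a or b. *)
Lemma gap_shift (a b k : 'I_n) : a < b ->
  (a <= k < b) == (a <= ord_pred k < b) = (k != a) && (k != b).
Proof.
move=> lt_ab; rewrite -!val_eqE /=; have lt_b := ltn_ord b; have lt_k :=
  ltn_ord k.
have [k0|k0] := posnP k.
  by rewrite k0 add0n /= modn_small //; clear -lt_ab lt_b; lia.
have -> : (k + n).-1 %% n = k.-1.
  by rewrite -subn1 -addnBAC // subn1 modnDr modn_small // (leq_ltn_trans
    (leq_pred _)).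
by clear -lt_ab lt_b k0; lia.
Qed.

(** Above and below the braid lie two faces.  A gap between consecutive
    crossings is merged only with the next gap across an erased crossing, so
    being in the part from a to b is an invariant of faces while a and b are
    kept. *)
Lemma splice_braid_face (S : {set {set braid_dart}}) (a b : 'I_n) d :
  S \subset double_points braid -> a < b ->
  (forall k (x : bool * bool), (k == a) || (k == b) -> vertex braid (k, x)
    \notin S) ->
  (d.1 == a) || (d.1 == b) ->
  ~~ fconnect (face (splice braid S set0)) d (braid_rot (braid_rot d)).
Proof.
move=> subS lt_ab abS dab; rewrite splice_seifert.
pose col z := match braid_face z with inr t => (true, t)
  | inl i => (false, a <= i < b) end.
have same k x : vertex braid (k, x) \in S -> (a <= ord_pred k < b)
  = (a <= k < b).
  move=> kS; apply/esym/eqP; rewrite gap_shift // -negb_or.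
  by apply: contraTN kS; apply: abS.
set Q := resolve _ _ _.
have colf z : col (face Q z) = col z.
  rewrite /face /=; case: ifP => [zS|_].
    case: z zS => i [r t] /= zS; rewrite braid_seifert negbK.
    by case: r t zS => [] [] //= /same E; rewrite /col /= -E ?ordSK.
  by case: z => i [[] []]; rewrite /col /= ?(congr1 val (ordSK i)) //;
    have /= -> := congr1 val (ordSK i).
apply/negP => con; have : col d = col (braid_rot (braid_rot d)).
  by move: con => /iter_findex <-; elim: (findex _ _ _) => //= k ->;
    rewrite colf.
have : (a <= d.1 < b) != (a <= ord_pred d.1 < b).
  by rewrite gap_shift // -negb_or negbK.
by case: d {con dab} => k [[] []] ne; rewrite /col /= => -[] // E;
  rewrite E eqxx in ne.
Qed.

Lemma splice_braid_nugatory (S : {set {set braid_dart}}) c v :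
  S \subset double_points braid -> nugatory (splice braid S set0) c ->
  v \in double_points (splice braid S set0) -> v = c.
Proof.
have wf := braid_wf; have sc := braid_single; have orB := braid_orientation.
have pg := seifert_pairing wf sc orB.
move=> subS [+ [d dc con]]; rewrite splice_seifert resolve_double // !inE.
move=> /andP[cS cP] /andP[vS /doubleP[e Ev _]].
have [Ec _] := double_mem wf cP dc; rewrite Ec in cS *; rewrite Ev in vS *.
move: con; rewrite splice_seifert; set Q := resolve _ _ _.
have -> : rot Q (rot Q d) = braid_rot (braid_rot d).
  by rewrite /= (negPf cS) (vertex_rot wf) (negPf cS).
move=> con; apply/eqP; rewrite braid_vertex; apply: contraT => ed.
have notS k x : (k == d.1) || (k == e.1) -> vertex braid (k, x) \notin S.
  case/orP=> /eqP ->; [have E : vertex braid (d.1, x) == vertex braid d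
     | have E : vertex braid (e.1, x) == vertex braid e];
       rewrite ?braid_vertex //;
  by rewrite (eqP E).
move: con; rewrite /Q -splice_seifert => con; exfalso; move: con; apply/negP.
case: (ltngtP d.1 e.1) => [lt|lt|E].
- by apply: (splice_braid_face (a := d.1) (b := e.1)); rewrite ?eqxx.
- apply: (splice_braid_face (a := e.1) (b := d.1)); rewrite ?eqxx ?orbT // =>
  k x.
  by rewrite orbC; apply: notS.
by case/eqP: ed; apply: val_inj.
Qed.

Lemma braid_reduced : reduced braid.
Proof.
split; first split; first split.
- exact: braid_wf.
- exact: braid_single.
- exact: braid_spherical.
- by apply/set0Pn; exists (vertex braid (ord0, (true, true)));
  apply: braid_double.
- exact: braid_order.
case=> c nug; have E : splice braid set0 set0 = braid by rewrite splice_seifert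
  resolve0.
rewrite -E in nug; have all_c d : vertex braid d = c.
  by apply: splice_braid_nugatory (sub0set _) nug _; rewrite E braid_double.
have : vertex braid (ord0, (true, true)) == vertex braid (ord_max, (true,
  true)).
  by rewrite !all_c.
by rewrite braid_vertex /= -val_eqE /= eq_sym double_eq0 eqn0Ngt m_gt0.
Qed.

Lemma braid_is_i : is_i braid m.*2.
Proof.
have [t [r [y [i [_ _ _ i_least]]]]] := reductivities_exist braid_reduced.
suff <- : i = m.*2 by [].
have [[S [subS cardS [_ [c nug]]]] _] := i_least.
have wf := braid_wf; have pg := seifert_pairing wf braid_single
  braid_orientation.
have E : double_points (splice braid S set0) = double_points braid :\: S.
  by rewrite splice_seifert resolve_double.
have card1 : #|double_points (splice braid S set0)| = 1.
  apply/eqP/cards1P; exists c; apply/setP=> v; rewrite inE.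
  apply/idP/eqP => [vP|->]; first exact: splice_braid_nugatory nug vP.
  by case: nug.
move: card1; rewrite E cardsD (setIidPr subS) card_braid_double cardS.
by have := subset_leq_card subS; rewrite cardS card_braid_double /n; clear; lia.
Qed.

End Torus.

Theorem proposition1 :
  (forall (D : finType) (P : diagram D), reduced P ->
    exists t r y i : nat,
      (is_t P t /\ is_r P r /\ is_y P y /\ is_i P i) /\
      t <= r /\
      t <= y /\
      t <= i /\
      ~~ odd i /\
      ((exists d, coherent_2gon P d) -> i = 2) /\
      ((exists d, type_C_3gon P d) -> i = 2) /\
      ((exists d, type_A_3gon P d) -> 1 <= y <= 2)) /\
  (forall m : nat, 0 < m ->
    exists (D : finType) (P : diagram D), reduced P /\ is_i P m.*2).
Proof.
split=> [D P redP|m m_gt0]; last first.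
  by exists (braid_dart m), (braid m); split; [exact: braid_reduced | exact: braid_is_i].
have [t [r [y [i [Ht Hr Hy Hi]]]]] := reductivities_exist redP.
exists t, r, y, i; split=> //.
split; first exact: (is_t_le_r redP Ht Hr).
split; first exact: (is_t_le_y Ht Hy).
split; first exact: (is_t_le_i Ht Hi).
split; first exact: (is_i_even redP Hi).
split.
  by case=> d /(coherent_2gon_reducible redP)[S [subS cardS redS]]; apply: (is_i_2 redP Hi subS).
split.
  by case=> d /(type_C_reducible redP)[S [subS cardS redS]]; apply: (is_i_2 redP Hi subS).
case=> d /(type_A_reducible redP)[N [subN cardN redN]].
by rewrite (is_y_gt0 redP Hy) (is_y_le Hy subN cardN redN).
Qed.
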